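(* Let $\mathcal{D}$ be a distribution over probability distributions on $\mathbb{R}$ such that, with probability $1$, the distribution $X\sim\mathcal{D}$ has no atoms. Let $q\in[0,1]$, $\epsilon>0$. The three-phase quantile estimator (described in the context) uses in expectation $O(1/\epsilon+\sigma_q^2/\epsilon^2)$ samples from $\mathcal{D}$, and with probability at least an absolute positive constant it outputs $\hat N$ satisfying $|\Pr_{Y\sim M(\mathcal{D})}(Y\le\hat N)-q|\le\epsilon$.
   Context: $M(\mathcal{D})$ is the mixture distribution: $\Pr_{M(\mathcal{D})}[A]=\mathbb{E}_{X\sim\mathcal{D}}[\Pr_X[A]]$ (atomless under the hypothesis). For an atomless distribution $X$ on $\mathbb{R}$, $q_X(x)=\Pr_{Y\sim X}(Y\le x)$. Let $N$ be the $q$-th quantile of $M(\mathcal{D})$, i.e. $N=\inf\{x: \Pr_{M(\mathcal{D})}(Y\le x)\ge q\}$, and $\sigma_q^2=\mathrm{Var}_{X\sim\mathcal{D}}[q_X(N)]$. Three-phase estimator (with sufficiently large absolute constants in the $O(\cdot)$): set $T_1=O(1/\epsilon)$; draw $X_1,\dots,X_{T_1}\sim\mathcal{D}$ and let $\tilde N$ be the $q$-th quantile of the mixture $M(X_1,\dots,X_{T_1})$ (uniform mixture of the sampled distributions); draw $X_{T_1+1},\dots,X_{2T_1}$ and set $\tilde\sigma^2=\frac1{T_1}\sum_{i=T_1+1}^{2T_1}(q_{X_i}(\tilde N)-q)^2$; set $T_2=O(1/\epsilon+\tilde\sigma^2/\epsilon^2)$; draw $X_{2T_1+1},\dots,X_{2T_1+T_2}$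 and return $\hat N$, the $q$-th quantile of the uniform mixture of these $T_2$ distributions.
   Formalization: The formal theorem assumes ε ≤ 1: for large ε the literal bound O(1/ε+σ_q²/ε²) tends to 0 while the estimator must draw at least one sample in each phase, and for ε ≥ 1 the accuracy requirement is vacuous. *)

(* Defs.v *)
From HB Require Import structures.
From mathcomp Require Import all_boot all_order all_algebra.
From mathcomp Require Import all_classical all_reals all_analysis.
From mathcomp Require Import measurable_realfun.
Set Implicit Arguments. Unset Strict Implicit. Unset Printing Implicit Defensive.
Import Order.TTheory GRing.Theory Num.Theory.
Import numFieldNormedType.Exports.
Local Open Scope classical_set_scope.
Local Open Scope ring_scope.

Section QuantileDefs.
Context {R : realType}.

Definition ecdf (X : probability R R) (e : \bar R) : R :=
  fine (X [set y : R | (y%:E <= e)%E]).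

Definition mix_cdf d (Om : measurableType d) (D : probability Om R)
  (X : Om -> probability R R) (e : \bar R) : R :=
  fine (\int[D]_w (X w [set y : R | (y%:E <= e)%E]))%E.

Definition quantile_of (G : R -> R) (q : R) : \bar R :=
  ereal_inf (EFin @` [set x : R | q <= G x]).

Definition mix_quantile d (Om : measurableType d) (D : probability Om R)
  (X : Om -> probability R R) (q : R) : \bar R :=
  quantile_of (fun x => mix_cdf D X x%:E) q.

Definition sigma_q2 d (Om : measurableType d) (D : probability Om R)
  (X : Om -> probability R R) (q : R) : R :=
  let N := mix_quantile D X q in
  let m := fine (\int[D]_w (ecdf (X w) N)%:E)%E in
  fine (\int[D]_w ((ecdf (X w) N - m) ^+ 2)%:E)%E.

Definition emp_cdf (Xs : nat -> probability R R) (a T : nat) (e : \bar R) : R :=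
  (\sum_(a <= i < a + T) ecdf (Xs i) e) / T%:R.

(* The three-phase estimator, with constants c1, c2, run on the sample
   sequence Xs (Xs i = the i-th distribution drawn from D). *)
Definition est_T1 (c1 eps : R) : nat := (Num.truncn (c1 / eps)).+1.

Definition est_Ntilde (c1 eps q : R) (Xs : nat -> probability R R) : \bar R :=
  quantile_of (fun x => emp_cdf Xs 0 (est_T1 c1 eps) x%:E) q.

Definition est_sigma2 (c1 eps q : R) (Xs : nat -> probability R R) : R :=
  let T1 := est_T1 c1 eps in
  (\sum_(T1 <= i < T1 + T1) (ecdf (Xs i) (est_Ntilde c1 eps q Xs) - q) ^+ 2)
    / T1%:R.

Definition est_T2 (c1 c2 eps q : R) (Xs : nat -> probability R R) : nat :=
  (Num.truncn (c2 * (1 / eps + est_sigma2 c1 eps q Xs / eps ^+ 2))).+1.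

Definition est_samples (c1 c2 eps q : R) (Xs : nat -> probability R R) : nat :=
  (est_T1 c1 eps + est_T1 c1 eps + est_T2 c1 c2 eps q Xs)%N.

Definition est_output (c1 c2 eps q : R) (Xs : nat -> probability R R) : \bar R :=
  quantile_of
    (fun x => emp_cdf Xs (est_T1 c1 eps + est_T1 c1 eps)
                         (est_T2 c1 c2 eps q Xs) x%:E) q.

(* W is an i.i.d. sequence of D-distributed random elements of Om,
   defined on the probability space (Om', P): each W i is measurable with
   law D, and the W i are mutually independent (the finite-dimensional
   joint laws factor; taking A j = setT for unused j covers every finite
   subfamily). *)
Definition iid_seq d d' (Om : measurableType d) (Om' : measurableType d')
  (P : probability Om' R) (D : probability Om R) (W : nat -> Om' -> Om) : Prop :=
  [/\ (forall i, measurable_fun setT (W i)),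
      (forall i (A : set Om), measurable A -> P (W i @^-1` A) = D A) &
      (forall (n : nat) (A : nat -> set Om), (forall j, measurable (A j)) ->
         P (\bigcap_(j < n) (W j @^-1` A j)) =
         (\prod_(j < n) P (W j @^-1` A j))%E)].

End QuantileDefs.

(* Main.v *)
(* Write Y_e for the random variable X(-oo, e], F(e) for its mean, N for the true quantile, and
   s2 for the variance of Y_N. Since 0 <= Y <= 1, E (Y_e - q)^2 <= 2 |F(e) - q| + 2 s2, and a
   Bernstein-type exponential moment bound shows that the empirical quantile of n samples lands
   beyond a level where F = q + t or q - t with probability at most exp(- n rho(t)),
   rho(t) = t^2 / (8 (t + s2)).

   Expected size: summing this bound over the levels t_k = 2^k (s2 + 1/T1) shows that the second
   moment of Y at the first-phase quantile, about q, is O(s2 + 1/T1) on average; the exponential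
   decay avoids the logarithm that Chebyshev's inequality would cost.

   Success: if s2 <= eps then T2 >= c2 / eps already suffices. Otherwise the first-phase quantile
   lies between levels at distance s2/16 from q with high probability, and between these levels
   each summand of the variance estimate dominates the variable (Y_N - q)^2 / 2 - (Y_U - Y_L),
   of mean at least 3 s2 / 8, so the estimate is at least s2 / 8. In both cases T2 rho(eps) >= 60,
   and the exponential bound applies to the third batch, which is independent of T2. *)
Require Import Defs.
From HB Require Import structures.
From mathcomp Require Import all_boot all_order all_algebra.
From mathcomp Require Import all_classical all_reals all_analysis.
From mathcomp Require Import measurable_realfun.
From mathcomp Require Import ring lra.
Set Implicit Arguments.
Unset Strict Implicit.
Unset Printing Implicit Defensive.
Import Order.TTheory GRing.Theory Num.Theory.
Import numFieldNormedType.Exports.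
Local Open Scope classical_set_scope.
Local Open Scope ring_scope.

(** * Distribution functions and quantiles *)

Section real_inequalities.
Context {R : realType}.
Implicit Types x y : R.

(** Squaring [exp (- x / 2) >= 1 - x / 2 >= 0] bounds [exp (- x)] from below, so it suffices that
    [(1 + x + x ^ 2) (1 - x / 2) ^ 2 >= 1]. This reduces to [1 - 3 x + x ^ 2 >= 0], which holds for
    [|x| <= 1 / 4]. *)
Lemma expR_le_quadratic x : `|x| <= 4^-1 -> expR x <= 1 + x + x ^+ 2.
Proof.
rewrite ler_norml => /andP[xl xr].
have h1 : 1 - x / 2 <= expR (- (x / 2)) by have := expR_ge1Dx (- (x / 2)).
have h2 : (1 - x / 2) ^+ 2 <= expR (- x).
  rewrite (_ : - x = - (x / 2) + - (x / 2)); last by lra.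
  rewrite expRD -expr2 lerXn2r// ?nnegrE ?expR_ge0//; lra.
have e0 := expR_gt0 x.
have : expR x * (1 - x / 2) ^+ 2 <= 1.
  rewrite (le_trans (ler_wpM2l (ltW e0) h2))// -expRD subrr expR0//.
move=> h3.
have h4 : 1 <= (1 + x + x ^+ 2) * (1 - x / 2) ^+ 2.
  have -> : (1 + x + x ^+ 2) * (1 - x / 2) ^+ 2 =
     1 + x ^+ 2 / 4 * (1 - 3 * x + x ^+ 2) by field.
  rewrite lerDl; apply: mulr_ge0; first by have := sqr_ge0 x; lra.
  by have := sqr_ge0 x; lra.
have p : 0 < (1 - x / 2) ^+ 2 by apply: exprn_gt0; lra.
by rewrite -(ler_pM2r p) (le_trans h3).
Qed.

Lemma expRN_le_inv x : 0 <= x -> expR (- x) <= (1 + x)^-1.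
Proof.
move=> x0; rewrite expRN lef_pV2 ?posrE ?expR_gt0//; last by lra.
exact: expR_ge1Dx.
Qed.

(** Quadratic decay is what the dyadic sum over brackets needs: it outweighs the factor [2 ^ k] of
    the bracket widths. *)
Lemma expRN_le_inv_sqr x : 0 < x -> expR (- x) <= 4 / x ^+ 2.
Proof.
move=> x0; rewrite (_ : - x = - (x / 2) + - (x / 2)); last by lra.
have h : expR (- (x / 2)) <= (x / 2)^-1.
  have xh : 0 < x / 2 by lra.
  apply: le_trans (expRN_le_inv (ltW xh)) _.
  by rewrite lef_pV2 ?posrE//; lra.
rewrite expRD (_ : 4 / x ^+ 2 = (x / 2)^-1 * (x / 2)^-1); last by field; lra.
by apply: ler_pM; rewrite ?expR_ge0.
Qed.

End real_inequalities.

(** * Continuity of distribution functions at extended real levels *)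

Section ecdf.
Context {R : realType}.
Implicit Types (mu : probability R R) (e : \bar R).

Lemma measurable_le_ereal e : measurable [set y : R | (y%:E <= e)%E].
Proof.
case: e => [r| |].
- have -> : [set y : R | (y%:E <= r%:E)%E] = `]-oo, r]%classic.
    by apply/seteqP; split=> y /=; rewrite lee_fin in_itv.
  exact: measurable_itv.
- have -> : [set y : R | (y%:E <= +oo)%E] = setT.
    by apply/seteqP; split=> y //= _; exact: leey.
  exact: measurableT.
- have -> : [set y : R | (y%:E <= -oo)%E] = set0 by apply/seteqP; split=> y.
  exact: measurable0.
Qed.

Lemma ecdfE mu e : (ecdf mu e)%:E = mu [set y : R | (y%:E <= e)%E].
Proof. by rewrite /ecdf fineK// fin_num_measure//; exact: measurable_le_ereal. Qed.

Lemma ecdf_ge0 mu e : 0 <= ecdf mu e.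
Proof. by rewrite -lee_fin ecdfE. Qed.

Lemma ecdf_le1 mu e : ecdf mu e <= 1.
Proof. by rewrite -lee_fin ecdfE probability_le1//; exact: measurable_le_ereal. Qed.

Lemma le_ecdf mu e e' : (e <= e')%E -> ecdf mu e <= ecdf mu e'.
Proof.
move=> ee'; rewrite -lee_fin !ecdfE le_measure ?inE//; last first.
  by move=> y /= /le_trans; exact.
all: exact: measurable_le_ereal.
Qed.

Lemma ecdf_pinfty mu : ecdf mu +oo%E = 1.
Proof.
apply: EFin_inj; rewrite ecdfE -(@probability_setT _ _ _ mu); congr (mu _).
by apply/seteqP; split=> y //= _; exact: leey.
Qed.

Lemma ecdf_ninfty mu : ecdf mu -oo%E = 0.
Proof.
by apply: EFin_inj; rewrite ecdfE -[RHS](measure0 mu); congr (mu _); apply/seteqP; split.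
Qed.

(** The level [-oo] is covered along with the reals because a quantile may be infinite, for instance
    at [q = 0]. *)
Lemma nonincreasing_seq_to_ereal e : (e < +oo)%E ->
  exists u : nat -> R, [/\ {homo u : n m / (n <= m)%N >-> m <= n},
    forall n, (e < (u n)%:E)%E & forall y : R, (forall n, y <= u n) -> (y%:E <= e)%E].
Proof.
case: e => [r| |]// _.
- exists (fun n => r + n.+1%:R^-1); split.
  + by move=> n m nm; rewrite lerD2l lef_pV2 ?posrE// ler_nat.
  + by move=> n; rewrite lte_fin ltrDl.
  + move=> y yn; rewrite lee_fin; apply/ler_addgt0Pr => eps eps0.
    have [n _] := near_infty_natSinv_lt (PosNum eps0) => /(_ n (leqnn n)) /= nlt.
    by rewrite (le_trans (yn n))// lerD2l ltW.
- exists (fun n => - n%:R); split.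
  + by move=> n m nm; rewrite lerN2 ler_nat.
  + by move=> n; rewrite ltNye.
  + move=> y yn; have h1 := yn (Num.truncn (- y)).+1.
    have h2 := truncnS_gt (- y); exfalso; lra.
Qed.

Lemma nondecreasing_seq_to_ereal e : (-oo < e)%E ->
  exists u : nat -> R, [/\ {homo u : n m / (n <= m)%N >-> n <= m},
    forall n, ((u n)%:E < e)%E & forall y : R, (y%:E < e)%E -> exists n, y <= u n].
Proof.
rewrite -[-oo%E]/(- +oo)%E lteNl => /nonincreasing_seq_to_ereal[u [u1 u2 u3]].
exists (fun n => - u n); split.
- by move=> n m nm; rewrite lerN2 u1.
- by move=> n; rewrite EFinN lteNl.
- move=> y ye; apply: contrapT => /forallNP H.
  have /u3 : forall n, - y <= u n.
    by move=> n; rewrite lerNl; have /negP := H n; rewrite -ltNge => /ltW.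
  by rewrite EFinN leeN2 leNgt ye.
Qed.

Lemma ecdf_right_continuous mu e t : (e < +oo)%E -> ecdf mu e < t ->
  exists r : R, (e < r%:E)%E /\ ecdf mu r%:E < t.
Proof.
move=> /nonincreasing_seq_to_ereal[u [u1 u2 u3]] et.
pose F n := [set y : R | (y%:E <= (u n)%:E)%E].
have FE : \bigcap_n F n = [set y : R | (y%:E <= e)%E].
  apply/seteqP; split=> y /=.
    by move=> H; apply: u3 => n; rewrite -lee_fin; exact: H.
  by move=> ye n _; rewrite /F /= (le_trans ye)// ltW.
have mF n : measurable (F n) by exact: measurable_le_ereal.
have : (mu \o F) x @[x --> \oo] --> mu (\bigcap_n F n).
  apply: nonincreasing_cvg_mu => //.
  - by rewrite -ge0_fin_numE// fin_num_measure.
  - by rewrite FE; exact: measurable_le_ereal.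
  - move=> n m nm; apply/subsetPset => y /=; rewrite /F/= !lee_fin => /le_trans.
    by apply; exact: u1.
rewrite FE -ecdfE => H.
have /existsNP[n] : ~ forall n, t <= ecdf mu (u n)%:E.
  move=> tu; move: et; rewrite ltNge -lee_fin => /negP; apply.
  by apply: cvge_ge H; apply: nearW => n; rewrite /= -ecdfE lee_fin.
by move=> /negP; rewrite -ltNge => ?; exists (u n).
Qed.

(** Continuity from below only reaches the open ray below [e]; atomlessness supplies the
    endpoint. *)
Lemma ecdf_left_continuous mu e t : (forall x, mu [set x] = 0%E) ->
  0 <= t -> t < ecdf mu e -> exists r : R, (r%:E < e)%E /\ t < ecdf mu r%:E.
Proof.
move=> mu0 t0 te.
have /nondecreasing_seq_to_ereal[u [u1 u2 u3]] : (-oo < e)%E.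
  by rewrite ltNge leeNy_eq; apply: contraPN te => /eqP ->; rewrite ecdf_ninfty; lra.
pose F n := [set y : R | (y%:E <= (u n)%:E)%E].
have mF n : measurable (F n) by exact: measurable_le_ereal.
have mbF : measurable (\bigcup_n F n) by exact: bigcupT_measurable.
have FE : mu [set y : R | (y%:E <= e)%E] = mu (\bigcup_n F n).
  apply/eqP; rewrite eq_le; apply/andP; split; last first.
    rewrite le_measure ?inE//; first exact: measurable_le_ereal.
    by move=> y [n _] /= /le_trans; apply; exact/ltW.
  (* [A] is the endpoint: the singleton of [e] when [e] is real, and empty when [e] is infinite. *)
  have [A [mA A0 sub]] : exists A : set R, [/\ measurable A, mu A = 0%E &
      [set y : R | (y%:E <= e)%E] `<=` \bigcup_n F n `|` A].
    have sub (A : set R) : (forall y, y%:E = e -> A y) ->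
        [set y : R | (y%:E <= e)%E] `<=` \bigcup_n F n `|` A.
      move=> HA y /=; rewrite le_eqVlt => /orP[/eqP/HA|/u3[n yn]]; first by right.
      by left; exists n.
    case: e {te u2 u3 u1 mF mbF} sub => [r| |] sub.
    - by exists [set r]; split=> //; apply: sub => y [].
    - by exists set0; split; rewrite ?measure0//; apply: sub.
    - by exists set0; split; rewrite ?measure0//; apply: sub.
  rewrite (le_trans (le_measure _ _ _ sub)) ?inE//; first exact: measurable_le_ereal.
    exact: measurableU.
  by rewrite (le_trans (measureU2 _ _ _))//; rewrite -[leRHS]adde0 leeD2l// -A0.
have : (mu \o F) x @[x --> \oo] --> mu (\bigcup_n F n).
  apply: nondecreasing_cvg_mu => //.
  move=> n m nm; apply/subsetPset => y /=; rewrite /F/= !lee_fin => /le_trans.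
  by apply; exact: u1.
rewrite -FE -ecdfE => H.
have /existsNP[n] : ~ forall n, ecdf mu (u n)%:E <= t.
  move=> tu; move: te; rewrite ltNge -lee_fin => /negP; apply.
  by apply: cvge_le H; apply: nearW => n; rewrite /= -ecdfE lee_fin.
by move=> /negP; rewrite -ltNge => ?; exists (u n).
Qed.

Lemma quantile_le (G : R -> R) q x : q <= G x -> (quantile_of G q <= x%:E)%E.
Proof. by move=> qG; apply: ereal_inf_lbound; exists x. Qed.

Lemma quantile_lt (G : R -> R) q e : (quantile_of G q < e)%E ->
  exists2 x, (x%:E < e)%E & q <= G x.
Proof. by move=> /ereal_inf_lt[_ [x /= qG <-] xe]; exists x. Qed.

(** A value above [q] would persist slightly to the left of the quantile, and a value below [q]
    slightly to the right; each contradicts the infimum. *)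
Lemma ecdf_quantile mu q : (forall x, mu [set x] = 0%E) -> 0 <= q <= 1 ->
  ecdf mu (quantile_of (fun x => ecdf mu x%:E) q) = q.
Proof.
move=> mu0 /andP[q0 q1]; apply/eqP; rewrite eq_le; apply/andP; split.
  rewrite leNgt; apply/negP => /(ecdf_left_continuous mu0 q0)[r [re qr]].
  by have := quantile_le (G := fun x => ecdf mu x%:E) (ltW qr); rewrite leNgt re.
rewrite leNgt; apply/negP => lt.
have /ecdf_right_continuous : (quantile_of (fun x => ecdf mu x%:E) q < +oo)%E.
  rewrite ltNge leye_eq; apply: contraPN lt => /eqP ->.
  by rewrite ecdf_pinfty ltNge q1.
move=> /(_ _ _ lt)[r [/quantile_lt[x xr qx] rq]].
by have := le_ecdf mu (ltW xr); rewrite leNgt (lt_le_trans rq).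
Qed.

End ecdf.

(** * Measurability of the estimator *)

Section measurability.
Context {R : realType} {d} {T : measurableType d}.
Implicit Types (f : T -> R) (e : \bar R) (Y : T -> probability R R).

Lemma measurable_fun_lt_real f :
  (forall t : R, measurable [set w | f w < t]) -> measurable_fun setT f.
Proof.
move=> mf; apply: (measurability _ (RGenInftyO.measurableE R)) => _ [_ [t ->] <-].
rewrite setTI (_ : _ @^-1` _ = [set w | f w < t])//.
Qed.

Lemma measurable_fun_lt_ereal (f : T -> \bar R) :
  (forall t : R, measurable [set w | (f w < t%:E)%E]) -> measurable_fun setT f.
Proof.
move=> mf; apply: (measurability _ (ErealGenInftyO.measurableE R)) => _ [_ [t ->] <-].
rewrite setTI (_ : _ @^-1` _ = [set w | (f w < t%:E)%E])//.
Qed.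

Lemma measurable_lt_real f t : measurable_fun setT f -> measurable [set w | f w < t].
Proof.
move=> mf; rewrite (_ : [set w | f w < t] = setT `&` f @^-1` `]-oo, t[%classic).
  by apply: mf => //; exact: measurable_itv.
by rewrite setTI; apply/seteqP; split=> w /=; rewrite in_itv.
Qed.

Lemma measurable_lt_ereal (f : T -> \bar R) e :
  measurable_fun setT f -> measurable [set w | (f w < e)%E].
Proof.
move=> mf; rewrite (_ : [set w | (f w < e)%E] = setT `&` f @^-1` `]-oo, e[%classic).
  by apply: mf => //; exact: emeasurable_itv.
by rewrite setTI; apply/seteqP; split=> w /=; rewrite in_itv.
Qed.

Lemma measurable_gt_ereal (f : T -> \bar R) e :
  measurable_fun setT f -> measurable [set w | (e < f w)%E].
Proof.
move=> mf; rewrite (_ : [set w | (e < f w)%E] = setT `&` f @^-1` `]e, +oo[%classic).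
  by apply: mf => //; exact: emeasurable_itv.
by rewrite setTI; apply/seteqP; split=> w /=; rewrite in_itv /= andbT.
Qed.

Lemma rat_between_ereal e (r : R) : (e < r%:E)%E ->
  exists s : rat, (e < (ratr s : R)%:E)%E /\ ratr s < r.
Proof.
move=> er; have [x ex xr] : exists2 x : R, (e <= x%:E)%E & x < r.
  case: e er => [x| |]// xr; first by exists x.
  by exists (r - 1); rewrite ?leNye//; lra.
have [s] := rat_in_itvoo xr; rewrite in_itv /= => /andP[xs sr].
by exists s; split=> //; rewrite (le_lt_trans ex) ?lte_fin.
Qed.

(** By monotonicity, the quantile is below [t] exactly when [G w] reaches [q] at some rational below
    [t], which leaves a countable union. *)
Lemma measurable_quantile_of (G : T -> R -> R) q :
  (forall x, measurable_fun setT (G ^~ x)) ->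
  (forall w, {homo G w : x y / x <= y}) ->
  measurable_fun setT (fun w => quantile_of (G w) q).
Proof.
move=> mG monoG; apply: measurable_fun_lt_ereal => t.
rewrite (_ : [set w | _] = \bigcup_(s : rat)
    ([set w | ratr s < t] `&` ~` [set w | G w (ratr s) < q])).
  apply: bigcupT_measurable_rat => s; apply: measurableI; last first.
    by apply: measurableC; exact: measurable_lt_real.
  by case: (ltP (ratr s) t) => st; [rewrite (_ : mkset _ = setT)|
    rewrite (_ : mkset _ = set0)]; rewrite // predeqE.
apply/seteqP; split=> w /=.
  move=> /quantile_lt[x]; rewrite lte_fin => xt qx.
  have [s] := rat_in_itvoo xt; rewrite in_itv /= => /andP[xs st].
  exists s => //; split=> //=; apply/negP; rewrite -leNgt (le_trans qx)//.
  by apply: monoG; exact: ltW.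
move=> [s _ [/= st /negP]]; rewrite -leNgt => qs.
by rewrite (le_lt_trans (quantile_le qs))// lte_fin.
Qed.

(** The domain is arbitrary so that the notion can also be read on the coarser sigma-algebra of the
    first samples. *)
Definition measurable_kernel Y :=
  forall A : set R, measurable A -> measurable_fun setT (fun w => Y w A).

Lemma measurable_ecdf_at Y e : measurable_kernel Y ->
  measurable_fun setT (fun w => ecdf (Y w) e).
Proof.
move=> mY; apply/measurable_EFinP; rewrite /comp.
under eq_fun do rewrite ecdfE.
exact: mY (measurable_le_ereal e).
Qed.

(* By right continuity, [ecdf (Y w) (Q w) < t] is witnessed at a rational above [Q w]. *)
Lemma measurable_ecdf Y (Q : T -> \bar R) :
  measurable_kernel Y -> measurable_fun setT Q ->
  measurable_fun setT (fun w => ecdf (Y w) (Q w)).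
Proof.
move=> mY mQ; apply: measurable_fun_lt_real => t.
(* The last set covers [Q w = +oo], above which there is no rational and where the distribution
   function is 1. *)
rewrite (_ : [set w | _] =
    (\bigcup_(s : rat) ([set w | (Q w < (ratr s)%:E)%E] `&`
      [set w | ecdf (Y w) (ratr s)%:E < t])) `|`
    (~` [set w | (Q w < +oo)%E] `&` [set w | (cst 1 : T -> R) w < t])).
  apply: measurableU.
    apply: bigcupT_measurable_rat => s; apply: measurableI.
      exact: measurable_lt_ereal.
    by apply: measurable_lt_real; exact: measurable_ecdf_at.
  apply: measurableI; first by apply: measurableC; exact: measurable_lt_ereal.
  exact: measurable_lt_real.
apply/seteqP; split=> w /=.
  move=> Qt; have [Qoo|ooQ] := ltP (Q w) +oo%E; last first.
    right; split=> //; move: ooQ Qt; rewrite leye_eq => /eqP ->.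
    by rewrite ecdf_pinfty.
  have [r [/rat_between_ereal[s [Qs sr]] rt]] := ecdf_right_continuous Qoo Qt.
  left; exists s => //; split=> //=; rewrite (le_lt_trans _ rt)//.
  by apply: le_ecdf; rewrite lee_fin ltW.
move=> [[s _ [/= /ltW Qs]]|[/negP]].
  by apply: le_lt_trans; exact: le_ecdf.
by rewrite -leNgt leye_eq => /eqP ->; rewrite ecdf_pinfty.
Qed.

Lemma le_emp_cdf (Xs : nat -> probability R R) a n e e' :
  (e <= e')%E -> emp_cdf Xs a n e <= emp_cdf Xs a n e'.
Proof.
by move=> ee'; rewrite ler_wpM2r ?invr_ge0//; apply: ler_sum => i _; exact: le_ecdf.
Qed.

Section samples.
Context (Y : nat -> T -> probability R R).

Lemma measurable_sum_nat (f : nat -> T -> R) a n :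
  (forall i, (a <= i < a + n)%N -> measurable_fun setT (f i)) ->
  measurable_fun setT (fun w => \sum_(a <= i < a + n) f i w).
Proof.
move=> mf.
rewrite (_ : (fun w => _) = fun w => \sum_(i < n) f (i + a)%N w).
  by apply: measurable_sum => i; apply: mf; rewrite leq_addl addnC ltn_add2l ltn_ord.
by apply/funext => w; rewrite -{1}[a]add0n big_addn addKn big_mkord.
Qed.

Lemma measurable_emp_cdf a n e :
  (forall i, (a <= i < a + n)%N -> measurable_kernel (Y i)) ->
  measurable_fun setT (fun w => emp_cdf (Y ^~ w) a n e).
Proof.
move=> mY; apply: measurable_funM => //.
apply: (measurable_sum_nat (f := fun i w => ecdf (Y i w) e)) => i ain.
by apply: measurable_ecdf_at; exact: mY.
Qed.

Lemma measurable_emp_quantile a n q :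
  (forall i, (a <= i < a + n)%N -> measurable_kernel (Y i)) ->
  measurable_fun setT
    (fun w => quantile_of (fun x => emp_cdf (Y ^~ w) a n x%:E) q).
Proof.
move=> mY; apply: (measurable_quantile_of (G := fun w x => emp_cdf (Y ^~ w) a n x%:E)).
  by move=> x; exact: measurable_emp_cdf.
by move=> w x y xy; apply: le_emp_cdf; rewrite lee_fin.
Qed.

Context (c1 c2 eps q : R).
Let T1 := est_T1 c1 eps.
Context (mY : forall i, (i < T1 + T1)%N -> measurable_kernel (Y i)).

Lemma measurable_est_Ntilde :
  measurable_fun setT (fun w => est_Ntilde c1 eps q (Y ^~ w)).
Proof.
apply: measurable_emp_quantile => i; rewrite add0n => /= iT.
by apply: mY; rewrite (leq_trans iT)// leq_addr.
Qed.

Lemma measurable_est_sigma2 :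
  measurable_fun setT (fun w => est_sigma2 c1 eps q (Y ^~ w)).
Proof.
apply: measurable_funM => //.
apply: (measurable_sum_nat
  (f := fun i w => (ecdf (Y i w) (est_Ntilde c1 eps q (Y ^~ w)) - q) ^+ 2)).
move=> i /andP[_ iT]; apply: measurable_funX; apply: measurable_funB => //.
by apply: measurable_ecdf; [exact: mY|exact: measurable_est_Ntilde].
Qed.

(** Measurability is asked of the first [T1 + T1] kernels only, so the lemma also applies on the
    sigma-algebra of the first two batches; this is what separates [T2] from the third batch. *)
Lemma measurable_est_T2_eq n :
  measurable [set w | est_T2 c1 c2 eps q (Y ^~ w) = n].
Proof.
pose f w := c2 * (1 / eps + est_sigma2 c1 eps q (Y ^~ w) / eps ^+ 2).
have mf : measurable_fun setT f.
  apply: measurable_funM => //; apply: measurable_funD => //.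
  by apply: measurable_funM => //; exact: measurable_est_sigma2.
have le_T2 k : measurable [set w | (est_T2 c1 c2 eps q (Y ^~ w) <= k)%N].
  case: k => [|k]; first by rewrite (_ : mkset _ = set0)// predeqE.
  rewrite (_ : mkset _ = [set w | f w < k.+1%:R]); first exact: measurable_lt_real.
  by apply/seteqP; split=> w; rewrite /est_T2 /= ltnS truncn_le_nat.
case: n => [|n]; first by rewrite (_ : mkset _ = set0)// predeqE.
rewrite (_ : mkset _ = [set w | (est_T2 c1 c2 eps q (Y ^~ w) <= n.+1)%N] `&`
    ~` [set w | (est_T2 c1 c2 eps q (Y ^~ w) <= n)%N]).
  by apply: measurableI => //; exact: measurableC.
apply/seteqP; split=> w /=.
  by move=> ->; rewrite leqnn ltnn.
by move=> [h1 /negP]; rewrite -ltnNge => h2; apply/eqP; rewrite eqn_leq h1.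
Qed.

Lemma measurable_est_T2 :
  measurable_fun setT (fun w => ((est_T2 c1 c2 eps q (Y ^~ w))%:R : R)).
Proof.
apply: measurable_fun_lt_real => t.
rewrite (_ : mkset _ = \bigcup_(n in [set n | n%:R < t])
    [set w | est_T2 c1 c2 eps q (Y ^~ w) = n]).
  by apply: bigcup_measurable => n _; exact: measurable_est_T2_eq.
apply/seteqP; split=> w /=; first by move=> wt; exists (est_T2 c1 c2 eps q (Y ^~ w)).
by move=> [n /= nt ->].
Qed.

Lemma measurable_est_output : (forall i, measurable_kernel (Y i)) ->
  measurable_fun setT (fun w => est_output c1 c2 eps q (Y ^~ w)).
Proof.
move=> mY'; apply: measurable_fun_lt_ereal => t.
pose Q n w := quantile_of (fun x => emp_cdf (Y ^~ w) (T1 + T1) n x%:E) q.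
rewrite (_ : mkset _ = \bigcup_n ([set w | est_T2 c1 c2 eps q (Y ^~ w) = n] `&`
    [set w | (Q n w < t%:E)%E])).
  apply: bigcupT_measurable => n; apply: measurableI.
    exact: measurable_est_T2_eq.
  by apply: measurable_lt_ereal; apply: measurable_emp_quantile => i _.
apply/seteqP; split=> w /=.
  by move=> wt; exists (est_T2 c1 c2 eps q (Y ^~ w)).
by move=> [n _ [/= Tn]]; rewrite /Q -Tn.
Qed.

End samples.

End measurability.

(** * The mixture as a probability measure *)

Section mixture.
Context {R : realType} {d} {Om : measurableType d}.

(** This is the measure [M(D)], through which facts about [ecdf] carry over to [mix_cdf]. The
    argument [mX] lets the measure structure below, which rests on it, be attached to the term. *)
Definition mixture (D : probability Om R) (X : Om -> probability R R)
  (mX : measurable_kernel X) (A : set R) : \bar R := (\int[D]_w X w A)%E.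

Context (D : probability Om R) (X : Om -> probability R R) (mX : measurable_kernel X).

Let mixture0 : mixture D mX set0 = 0%E.
Proof. by rewrite /mixture integral0_eq. Qed.

Let mixture_ge0 A : (0 <= mixture D mX A)%E.
Proof. exact: integral_ge0. Qed.

Let mixture_sigma_additive : semi_sigma_additive (mixture D mX).
Proof.
move=> F mF tF _; rewrite [X in _ --> X](_ : _ =
    (\int[D]_w (\sum_(0 <= k <oo) X w (F k)))%E); last first.
  by apply: eq_integral => w _; apply/esym/cvg_lim => //; exact: measure_sigma_additive.
rewrite [X in X @ _](_ : _ =
    (fun n => (\int[D]_w (\sum_(0 <= i < n) X w (F i)))%E)); last first.
  by apply/funext => n; rewrite -ge0_integral_sum// => i; exact: mX.
apply: cvg_monotone_convergence => //.
- by move=> n; apply: emeasurable_sum => m; exact: mX.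
- by move=> n x _; rewrite sume_ge0.
- by move=> x _ m n mn; exact: ereal_nondecreasing_series.
Qed.

HB.instance Definition _ := isMeasure.Build _ _ _ (mixture D mX)
  mixture0 mixture_ge0 mixture_sigma_additive.

Let mixture_setT : mixture D mX setT = 1%E.
Proof.
rewrite /mixture; under eq_integral do rewrite probability_setT.
by rewrite integral_cst// mul1e; exact: probability_setT.
Qed.

HB.instance Definition _ := Measure_isProbability.Build _ _ _ (mixture D mX) mixture_setT.

Lemma mix_cdfE e : mix_cdf D X e = ecdf (mixture D mX) e.
Proof. by []. Qed.

Lemma mixture_atomless :
  {ae D, forall w, forall x : R, X w [set x] = 0%E} ->
  forall x, mixture D mX [set x] = 0%E.
Proof.
move=> X0 x; rewrite /mixture (ge0_ae_eq_integral (g := cst 0%E))//.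
- by rewrite integral0.
- exact: mX.
- by apply: filterS X0 => w X0 _; exact: X0.
Qed.

Lemma integral_ecdf e : (\int[D]_w (ecdf (X w) e)%:E)%E = (mix_cdf D X e)%:E.
Proof.
rewrite mix_cdfE ecdfE; apply: eq_integral => w _.
exact: ecdfE.
Qed.

End mixture.

(** * Independence of a sample from the past *)

Lemma integral_probability_one {R : realType} {d} {T : measurableType d} (P : probability T R) :
  (\int[P]_w 1 = 1)%E.
Proof. by rewrite integral_cst// mul1e; exact: probability_setT. Qed.

Section independence.
Context {R : realType} {d d'} {Om : measurableType d} {Om' : measurableType d'}.
Context (P : probability Om' R) (D : probability Om R) (W : nat -> Om' -> Om).

(** These events form a pi-system on which independence is a product formula. *)
Definition past_cylinders m : set (set Om') :=
  [set E | exists2 A : nat -> set Om, (forall j, measurable (A j)) &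
    E = \bigcap_(j in `I_m) (W j @^-1` A j)].

(* The sample space with the sigma-algebra generated by the first [m] samples. *)
Definition past m := g_sigma_algebraType (past_cylinders m).

Lemma past_cylinders_setI m : setI_closed (past_cylinders m).
Proof.
move=> _ _ [A mA ->] [B mB ->]; exists (fun j => A j `&` B j).
  by move=> j; exact: measurableI.
by rewrite -bigcapI.
Qed.

Lemma past_cylinders_setT m : past_cylinders m setT.
Proof.
exists (fun=> setT) => //; apply/esym; apply/seteqP; split=> // w _ j _ //.
Qed.

Lemma measurable_sample_past m j : (j < m)%N ->
  measurable_fun setT (W j : past m -> Om).
Proof.
move=> jm _ B mB; rewrite setTI; apply: sub_sigma_algebra.
exists (fun i => if i == j then B else setT).
  by move=> i; case: ifP.
apply/seteqP; split=> w /=.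
  by move=> wB i _; case: eqP => [->|].
by move=> /(_ j jm) /=; rewrite eqxx.
Qed.

Context (iidW : iid_seq P D W).

Lemma measurable_sample j : measurable_fun setT (W j).
Proof. by case: iidW. Qed.

Lemma measurable_past m (E : set (past m)) : measurable E -> measurable (E : set Om').
Proof.
apply: smallest_sub; first exact: sigma_algebra_measurable.
move=> _ [A mA ->]; apply: bigcap_measurableType => j _.
by rewrite -[X in measurable X]setTI; exact: measurable_sample.
Qed.

Lemma past_leq m n : (m <= n)%N -> forall d2 (S : measurableType d2) (f : Om' -> S),
  measurable_fun setT (f : past m -> S) -> measurable_fun setT (f : past n -> S).
Proof.
move=> mn d2 S f mf _ B mB.
have := mf measurableT B mB.
apply: smallest_sub; first exact: (sigma_algebra_measurable (past n)).
move=> _ [A mA ->]; apply: sub_sigma_algebra.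
exists (fun j => if (j < m)%N then A j else setT).
  by move=> j; case: ifP.
apply/seteqP; split=> w /=.
  by move=> wA j _; case: ifP => // jm; exact: wA.
by move=> wA j jm; have := wA j (leq_trans jm mn); rewrite jm.
Qed.

Let id_past m : Om' -> past m := id.

Let measurable_id_past m : measurable_fun setT (@id_past m).
Proof. by move=> _ B mB; rewrite setTI; exact: (@measurable_past m). Qed.

(** As functions of [E], both sides are finite measures on the past. They agree on cylinders by the
    product formula, hence on the generated sigma-algebra by uniqueness of measures on a
    pi-system. *)
Lemma past_independent m (E : set (past m)) B : measurable E -> measurable B ->
  P (E `&` W m @^-1` B) = (P E * D B)%E.
Proof.
move=> mE mB.
have mWB : measurable (W m @^-1` B).
  by rewrite -[X in measurable X]setTI; exact: measurable_sample.
have DB0 : 0 <= fine (D B) by rewrite fine_ge0.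
have DBE : (NngNum DB0)%:num%:E = D B by rewrite /= fineK// fin_num_measure.
pose m1 := [the measure _ _ of pushforward (mrestr P mWB) (@id_past m)].
pose m2 := [the measure _ _ of pushforward (mscale (NngNum DB0) P) (@id_past m)].
have mid := @measurable_id_past m.
have : m1 mid E = m2 mid E.
  apply: (@measure_unique _ _ (past m) (past_cylinders m) (fun=> setT)) => //.
  - exact: past_cylinders_setI.
  - by move=> _; exact: past_cylinders_setT.
  - by rewrite bigcup_const.
  - move=> A [F mF AE]; rewrite /m1 /m2 /= /pushforward /mrestr /mscale /= DBE.
    case: iidW => _ lawW indW.
    (* [G] appends [B] as one more coordinate, so that the intersection is a cylinder in [m + 1]
       samples. *)
    pose G j := if (j < m)%N then F j else B.
    have mG j : measurable (G j) by rewrite /G; case: ifP.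
    have AG : A `&` W m @^-1` B = \bigcap_(j < m.+1) (W j @^-1` G j).
      rewrite AE; apply/seteqP; split=> w /=.
        move=> [wF wB] j /=; rewrite ltnS leq_eqVlt => /orP[/eqP ->|jm].
          by rewrite /G ltnn.
        by rewrite /G /= jm; exact: wF.
      move=> wG; split.
        by move=> j /= jm; have := wG j (ltnW jm); rewrite /G /= jm.
      by have := wG m (ltnSn m); rewrite /G /= ltnn.
    have -> : @id_past m @^-1` A = A by [].
    rewrite AG indW// big_ord_recr /= [in X in (_ * P X)%E]/G ltnn lawW// muleC.
    congr (_ * _)%E; rewrite AE -[X in P X](_ : \bigcap_(j < m) (W j @^-1` G j) = _).
      by rewrite indW.
    by apply: eq_bigcapr => j /= jm; rewrite /G jm.
  - move=> _; rewrite /m1 /= /pushforward /mrestr /= -ge0_fin_numE ?measure_ge0//.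
    by rewrite fin_num_measure// setTI.
rewrite /m1 /m2 /= /pushforward /mrestr /mscale /= DBE => ->.
by rewrite muleC.
Qed.

(** Independence says that the joint law of the past and [W m] is the product of the law of the past
    and [D]; the formula is then Tonelli's theorem. *)
Lemma past_integral m (h : Om' -> \bar R) (g : Om -> \bar R) :
  (forall w, 0 <= h w)%E -> measurable_fun setT (h : past m -> \bar R) ->
  (forall x, 0 <= g x)%E -> measurable_fun setT g ->
  (\int[P]_w (h w * g (W m w)) = \int[P]_w h w * \int[D]_x g x)%E.
Proof.
move=> h0 mh g0 mg.
pose idm : {mfun Om' >-> past m} := mfun_Sub (mem_set (@measurable_id_past m)).
have mphi : measurable_fun setT (fun w : Om' => (idm w, W m w)).
  by apply: measurable_fun_pair => //; exact: measurable_sample.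
pose phi : {mfun Om' >-> (past m * Om)%type} := mfun_Sub (mem_set mphi).
pose P1 := distribution P idm.
pose f (z : past m * Om) := (h z.1 * g z.2)%E.
have mf : measurable_fun setT f.
  by apply: emeasurable_funM; apply: measurableT_comp.
have f0 z : (0 <= f z)%E by rewrite mule_ge0.
have -> : (\int[P]_w (h w * g (W m w)) = \int[distribution P phi]_z f z)%E.
  by rewrite ge0_integral_distribution.
transitivity (\int[P1 \x D]_z f z)%E.
  apply: eq_measure_integral => A mA _; apply/esym.
  apply: product_measure_unique => // B C mB mC.
  exact: past_independent mB mC.
rewrite fubini_tonelli1//= /fubini_F /f /=.
under eq_integral => x _ do rewrite ge0_integralZl//.
rewrite ge0_integralZr//; last exact: integral_ge0.
by congr (_ * _)%E; rewrite ge0_integral_distribution.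
Qed.

Lemma measurable_past_prod m n (g : Om -> R) :
  measurable_fun setT g ->
  measurable_fun setT ((fun w => \prod_(m <= j < m + n) g (W j w)) : past (m + n) -> R).
Proof.
move=> mg; apply: measurable_prod => j; rewrite mem_index_iota => /andP[_ jm].
by apply: measurableT_comp => //; exact: measurable_sample_past.
Qed.

(** The last factor is independent of everything before it and splits off, by induction. The weight
    [h] leaves room for an event determined by the earlier samples. *)
Lemma past_prod_le m n (h : Om' -> R) (g : Om -> R) a :
  (forall w, 0 <= h w) -> measurable_fun setT (h : past m -> R) ->
  (forall x, 0 <= g x) -> measurable_fun setT g ->
  0 <= a -> (\int[D]_x (g x)%:E <= a%:E)%E ->
  (\int[P]_w (h w * \prod_(m <= j < m + n) g (W j w))%:E <=
    (a ^+ n)%:E * \int[P]_w (h w)%:E)%E.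
Proof.
move=> h0 mh g0 mg a0 ga.
have p0 n' w : 0 <= \prod_(m <= j < m + n') g (W j w) by exact: prodr_ge0.
elim: n => [|n IH].
  by rewrite expr0 mul1e; under eq_integral do rewrite addn0 big_geq// mulr1.
pose h' w := h w * \prod_(m <= j < m + n) g (W j w).
have h'0 w : 0 <= h' w by rewrite mulr_ge0.
have mh' : measurable_fun setT (h' : past (m + n) -> R).
  apply: measurable_funM; last exact: measurable_past_prod.
  by apply: past_leq mh; exact: leq_addr.
under eq_integral do rewrite addnS big_nat_recr ?leq_addr//= mulrA EFinM.
rewrite (past_integral (h := EFin \o h') (g := EFin \o g))//=; first last.
- exact/measurable_EFinP.
- exact/measurable_EFinP.
have i0 : (0 <= \int[D]_x (g x)%:E)%E by apply: integral_ge0 => x _; rewrite lee_fin.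
have j0 : (0 <= \int[P]_w (h' w)%:E)%E by apply: integral_ge0 => x _; rewrite lee_fin.
rewrite (le_trans (lee_pmul _ _ IH ga))//.
by rewrite exprSr EFinM -!muleA [(_ * a%:E)%E]muleC.
Qed.

End independence.

(** * Exponential bounds for the empirical quantile *)

Section population.
Context {R : realType} {d} {Om : measurableType d}.
Context (D : probability Om R) (X : Om -> probability R R) (q : R).
Context (mX : measurable_kernel X)
  (X0 : {ae D, forall w, forall x : R, X w [set x] = 0%E}) (q01 : 0 <= q <= 1).

Local Notation Y e w := (ecdf (X w) e).
Local Notation F := (mix_cdf D X).
Local Notation N := (mix_quantile D X q).
Local Notation s2 := (sigma_q2 D X q).

Lemma mix_cdf_quantile s : 0 <= s <= 1 -> F (mix_quantile D X s) = s.
Proof.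
move=> s01; rewrite mix_cdfE; apply: (@ecdf_quantile _ (mixture D mX)) => //.
exact: mixture_atomless.
Qed.

Lemma le_mix_cdf e e' : (e <= e')%E -> F e <= F e'.
Proof. by rewrite !mix_cdfE; exact: le_ecdf. Qed.

Lemma mix_cdf_ge0 e : 0 <= F e. Proof. exact: (ecdf_ge0 (mixture D mX)). Qed.

Lemma mix_cdf_le1 e : F e <= 1. Proof. exact: (ecdf_le1 (mixture D mX)). Qed.

Lemma lt_mix_cdf e e' : F e < F e' -> (e <= e')%E.
Proof.
by move=> lt; rewrite leNgt; apply/negP => /ltW/le_mix_cdf; rewrite leNgt lt.
Qed.

Lemma bounded_integrable (f : Om -> R) M : measurable_fun setT f ->
  (forall w, `|f w| <= M) -> D.-integrable setT (EFin \o f).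
Proof.
move=> mf fM; apply: measurable_bounded_integrable => //.
  by rewrite -ge0_fin_numE// fin_num_measure.
exists M; split; first exact: num_real.
by move=> x Mx w _ /=; exact: le_trans (fM w) (ltW Mx).
Qed.

Let measurable_Y e : measurable_fun setT (fun w => Y e w).
Proof. exact: measurable_ecdf_at. Qed.

Let integrable_Y e : D.-integrable setT (EFin \o (fun w => Y e w)).
Proof.
apply: (bounded_integrable (M := 1)) => // w.
by rewrite ger0_norm ?ecdf_ge0 ?ecdf_le1.
Qed.

Let measurable_V : measurable_fun setT (fun w => (Y N w - q) ^+ 2).
Proof. by apply: measurable_funX; apply: measurable_funB. Qed.

Lemma sqr_ecdf_dev_le1 e w : (Y e w - q) ^+ 2 <= 1.
Proof.
rewrite -(real_normK (num_real _)) expr_le1// ler_norml.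
have := ecdf_ge0 (X w) e; have := ecdf_le1 (X w) e; move: q01 => /andP[]; lra.
Qed.

Let integrable_V : D.-integrable setT (EFin \o (fun w => (Y N w - q) ^+ 2)).
Proof.
apply: (bounded_integrable (M := 1)) => // w.
by rewrite ger0_norm ?sqr_ge0// sqr_ecdf_dev_le1.
Qed.

Lemma Rintegral_ecdf e : \int[D]_w Y e w = F e.
Proof. by rewrite /Rintegral integral_ecdf. Qed.

(** Atomlessness makes the mean of [Y N] equal to [q], so the variance is centred at [q]. *)
Lemma sigma_q2E : s2 = \int[D]_w (Y N w - q) ^+ 2.
Proof. by rewrite /sigma_q2 integral_ecdf//= mix_cdf_quantile. Qed.

Lemma sigma_q2_ge0 : 0 <= s2.
Proof. by rewrite sigma_q2E; apply: Rintegral_ge0 => w _; exact: sqr_ge0. Qed.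

Lemma sigma_q2_le1 : s2 <= 1.
Proof.
rewrite sigma_q2E; apply: (@le_trans _ _ (\int[D]_w (fun=> 1 : R) w)).
  apply: le_Rintegral => //; first exact: finite_measure_integrable_cst.
  by move=> w _; exact: sqr_ecdf_dev_le1.
rewrite Rintegral_cst// mul1r.
by rewrite (_ : fine _ = 1)//; exact: (congr1 fine (probability_setT D)).
Qed.

(** One-sample moments are bounded below by first bounding the integrand pointwise by such a
    combination, whose integral is explicit. *)
Lemma integral_le_combination (g : Om -> R) a b c k e e' :
  measurable_fun setT g -> (forall w, 0 <= g w) ->
  (forall w, g w <= a + b * Y e w + c * Y e' w + k * (Y N w - q) ^+ 2) ->
  (\int[D]_w (g w)%:E <= (a + b * F e + c * F e' + k * s2)%:E)%E.
Proof.
move=> mg g0 gle.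
have i1 : D.-integrable setT (EFin \o (fun=> a : R)).
  exact: finite_measure_integrable_cst.
have i2 : D.-integrable setT (EFin \o (fun w => b * Y e w)).
  exact: integrableZl (integrable_Y e).
have i3 : D.-integrable setT (EFin \o (fun w => c * Y e' w)).
  exact: integrableZl (integrable_Y e').
have i4 : D.-integrable setT (EFin \o (fun w => k * (Y N w - q) ^+ 2)).
  exact: integrableZl integrable_V.
have i12 := integrableD measurableT i1 i2.
have i123 := integrableD measurableT i12 i3.
have i := integrableD measurableT i123 i4.
pose r w := a + b * Y e w + c * Y e' w + k * (Y N w - q) ^+ 2.
have ir : D.-integrable setT (EFin \o r) by [].
have -> : a + b * F e + c * F e' + k * s2 = \int[D]_w r w.
  rewrite RintegralD// RintegralD// RintegralD// !RintegralZl//.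
  rewrite !Rintegral_ecdf -sigma_q2E Rintegral_cst//.
  rewrite -[X in X + _ + _ + _ = _]mulr1; congr (_ * _ + _ + _ + _).
  exact: (esym (congr1 fine (probability_setT D))).
rewrite /Rintegral fineK; last exact: integrable_fin_num.
apply: ge0_le_integral => //.
- by move=> w _; rewrite lee_fin.
- exact/measurable_EFinP.
- exact: measurable_int ir.
- by move=> w _; rewrite lee_fin.
Qed.

Definition rate t := t ^+ 2 / (8 * (t + s2)).

(** The minimiser of [1 - l t + 2 l ^ 2 (t + s2)] over [l]; the minimum is [1 - rate t]. It is at
    most [1 / 4], as the quadratic bound on the exponential requires. *)
Let lam t := t / (4 * (t + s2)).

Let lamE t : 0 < t -> [/\ 0 <= lam t, lam t <= 4^-1 & 
  1 - lam t * t + 2 * lam t ^+ 2 * (t + s2) <= expR (- rate t)].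
Proof.
move=> t0; have s0 := sigma_q2_ge0; have ts : 0 < t + s2 by lra.
split.
- by rewrite /lam divr_ge0; lra.
- by rewrite /lam ler_pdivrMr; lra.
- have -> : 1 - lam t * t + 2 * lam t ^+ 2 * (t + s2) = 1 + - rate t.
    by rewrite /lam /rate; field; lra.
  exact: expR_ge1Dx.
Qed.

(* Variance proxy: as distribution functions lie in [0, 1], (Y e - q)^2 is at most
   2 |Y e - Y N| + 2 (Y N - q)^2, whose mean is 2 t + 2 s2 at a level with F e = q +- t. *)
Let mgf_pointwise l e w : 0 <= l -> l <= 4^-1 ->
  expR (l * (Y e w - q)) <= 1 + l * (Y e w - q) +
    l ^+ 2 * (2 * `|Y e w - Y N w| + 2 * (Y N w - q) ^+ 2) /\
  expR (l * (q - Y e w)) <= 1 + l * (q - Y e w) +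
    l ^+ 2 * (2 * `|Y e w - Y N w| + 2 * (Y N w - q) ^+ 2).
Proof.
move=> l0 l4.
have y0 := ecdf_ge0 (X w) e; have y1 := ecdf_le1 (X w) e.
have n0 := ecdf_ge0 (X w) N; have n1 := ecdf_le1 (X w) N.
move: q01 => /andP[q0 q1].
have H : (Y e w - q) ^+ 2 <= 2 * `|Y e w - Y N w| + 2 * (Y N w - q) ^+ 2.
  have h1 : `|Y e w - Y N w| ^+ 2 <= `|Y e w - Y N w|.
    by rewrite expr2 ler_piMr// ler_norml; lra.
  rewrite (real_normK (num_real _)) in h1.
  have : (Y e w - q) ^+ 2 = 2 * (Y e w - Y N w) ^+ 2 + 2 * (Y N w - q) ^+ 2 -
    (Y e w - 2 * Y N w + q) ^+ 2 by ring.
  by have := sqr_ge0 (Y e w - 2 * Y N w + q); lra.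
have H2 := ler_wpM2l (sqr_ge0 l) H.
have lb x : `|x| <= 1 -> expR (l * x) <= 1 + l * x + l ^+ 2 * x ^+ 2.
  move=> x1; rewrite -exprMn; apply: expR_le_quadratic.
  rewrite normrM ger0_norm// -[leRHS]mulr1; apply: ler_pM => //.
split.
  have := lb (Y e w - q); rewrite ler_norml => lbw.
  by apply: le_trans (lbw _) _; [lra|rewrite lerD2l].
have := lb (q - Y e w); rewrite ler_norml => lbw.
apply: le_trans (lbw _) _; first lra.
by rewrite lerD2l -[q - _]opprB sqrrN.
Qed.

(** Since [N <= e], the absolute value in the variance proxy opens with a known sign. The bound is
    then linear in distribution functions, with integral [1 - l t + 2 l ^ 2 (t + s2)]. *)
Lemma mgf_upper t e : 0 < t -> F e = q + t ->
  (\int[D]_w (expR (lam t * (q - Y e w)))%:E <= (expR (- rate t))%:E)%E.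
Proof.
move=> t0 Fe; have [l0 l4 le] := lamE t0.
have Ne : (N <= e)%E by apply: lt_mix_cdf; rewrite mix_cdf_quantile// Fe ltrDl.
set l := lam t in l0 l4 le *.
apply: le_trans (integral_le_combination (a := 1 + l * q)
  (b := - l + 2 * l ^+ 2) (c := - (2 * l ^+ 2)) (k := 2 * l ^+ 2) (e := e) (e' := N) _ _ _) _.
- apply: measurableT_comp => //; apply: measurable_funM => //.
  exact: measurable_funB.
- by move=> w; exact: expR_ge0.
- move=> w; have [_] := mgf_pointwise e w l0 l4.
  rewrite ger0_norm; last by rewrite subr_ge0 le_ecdf.
  by move=> h; apply: le_trans h _; rewrite le_eqVlt; apply/orP; left; apply/eqP; ring.
- rewrite lee_fin mix_cdf_quantile// Fe (le_trans _ le)// le_eqVlt.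
  by apply/orP; left; apply/eqP; ring.
Qed.

Lemma mgf_lower t e : 0 < t -> F e = q - t ->
  (\int[D]_w (expR (lam t * (Y e w - q)))%:E <= (expR (- rate t))%:E)%E.
Proof.
move=> t0 Fe; have [l0 l4 le] := lamE t0.
have eN : (e <= N)%E by apply: lt_mix_cdf; rewrite mix_cdf_quantile// Fe; lra.
set l := lam t in l0 l4 le *.
apply: le_trans (integral_le_combination (a := 1 - l * q)
  (b := l - 2 * l ^+ 2) (c := 2 * l ^+ 2) (k := 2 * l ^+ 2) (e := e) (e' := N) _ _ _) _.
- apply: measurableT_comp => //; apply: measurable_funM => //.
  exact: measurable_funB.
- by move=> w; exact: expR_ge0.
- move=> w; have [+ _] := mgf_pointwise e w l0 l4.
  rewrite ler0_norm; last by rewrite subr_le0 le_ecdf.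
  by move=> h; apply: le_trans h _; rewrite le_eqVlt; apply/orP; left; apply/eqP; ring.
- rewrite lee_fin mix_cdf_quantile// Fe (le_trans _ le)// le_eqVlt.
  by apply/orP; left; apply/eqP; ring.
Qed.

Local Notation emp_quantile w a n :=
  (quantile_of (fun x => emp_cdf (fun i => X (w i)) a n x%:E) q).

(* Exponential weights [g] turn an overshoot of the empirical quantile of any [n]
   samples beyond [U] into [1 <= \prod g], a bound that only involves product
   functions of the samples. *)
Definition upper_certificate t (U : \bar R) (g : Om -> R) :=
  [/\ measurable_fun setT g, (forall x, 0 <= g x),
     (\int[D]_x (g x)%:E <= (expR (- rate t))%:E)%E &
     forall (w : nat -> Om) a n, (0 < n)%N -> (U < emp_quantile w a n)%E ->
       1 <= \prod_(a <= j < a + n) g (w j)].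

Definition lower_certificate t (L : \bar R) (h : Om -> R) :=
  [/\ measurable_fun setT h, (forall x, 0 <= h x),
     (\int[D]_x (h x)%:E <= (expR (- rate t))%:E)%E &
     forall (w : nat -> Om) a n, (0 < n)%N -> (emp_quantile w a n < L)%E ->
       1 <= \prod_(a <= j < a + n) h (w j)].

Lemma sum_ecdf_dev (w : nat -> Om) a n e : (0 < n)%N ->
  \sum_(a <= j < a + n) (Y e (w j) - q) =
  n%:R * (emp_cdf (fun i => X (w i)) a n e - q).
Proof.
move=> n0; rewrite sumrB /emp_cdf mulrBr; congr (_ - _).
  by rewrite mulrCA divff ?mulr1// pnatr_eq0 -lt0n.
by rewrite sumr_const_nat addKn mulr_natl.
Qed.

(** [U] is the quantile of the mixture at level [q + t]. If the empirical quantile exceeds [U], the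
    empirical distribution function is at most [q] there, so the exponents [q - Y U] have a
    nonnegative sum. The clause for [1 < t] will make the widest bracket the whole line. *)
Lemma upper_bracket t : 0 < t ->
  exists U g, [/\ (N <= U)%E, F U <= q + t, (1 < t -> U = +oo%E) & upper_certificate t U g].
Proof.
move=> t0; move: (q01) => /andP[q0 q1]; have [qt|qt] := leP (q + t) 1; last first.
  (* No level has [F = q + t] here; [+oo] is never exceeded, so the zero weight is a certificate. *)
  exists +oo%E, (fun=> 0); split=> //; first exact: leey.
    by apply: le_trans (mix_cdf_le1 _) _; exact: ltW.
  split=> //; last by move=> w a n _; rewrite ltNge leey.
  by rewrite integral0 lee_fin expR_ge0.
have FU : F (mix_quantile D X (q + t)) = q + t by apply: mix_cdf_quantile; lra.
set U := mix_quantile D X (q + t) in FU *.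
exists U, (fun x => expR (lam t * (q - Y U x))); split.
- by apply: lt_mix_cdf; rewrite mix_cdf_quantile// FU ltrDl.
- by rewrite FU.
- by move=> t1; exfalso; lra.
split.
- apply: measurableT_comp => //; apply: measurable_funM => //; exact: measurable_funB.
- by move=> x; exact: expR_ge0.
- exact: mgf_upper.
- move=> w a n n0 UQ; rewrite -expR_sum -expR0 ler_expR -mulr_sumr.
  have [l0 _ _] := lamE t0; apply: mulr_ge0 => //.
  have -> : \sum_(a <= j < a + n) (q - Y U (w j)) =
      - (n%:R * (emp_cdf (fun i => X (w i)) a n U - q)).
    by rewrite -sum_ecdf_dev// -sumrN; apply: eq_bigr => j _; rewrite opprB.
  rewrite oppr_ge0; apply: mulr_ge0_le0; first exact: ler0n.
  rewrite subr_le0 leNgt; apply/negP => qU.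
  have : (emp_quantile w a n <= U)%E.
    (* [U = -oo] is excluded because [F] vanishes there while [q + t > 0]. *)
    move: qU (FU); rewrite /U; case: (mix_quantile D X (q + t)) => [r /ltW qU _| _ _|_].
    - exact: quantile_le.
    - exact: leey.
    - by rewrite mix_cdfE (ecdf_ninfty (mixture D mX)) => qt0; exfalso; lra.
  by rewrite leNgt UQ.
Qed.

Lemma lower_bracket t : 0 < t ->
  exists L h, [/\ (L <= N)%E, q - t <= F L, (1 < t -> L = -oo%E) & lower_certificate t L h].
Proof.
move=> t0; move: (q01) => /andP[q0 q1]; have [qt|qt] := leP 0 (q - t); last first.
  exists -oo%E, (fun=> 0); split=> //; first exact: leNye.
    by apply: le_trans (ltW qt) _; exact: mix_cdf_ge0.
  split=> //; last by move=> w a n _; rewrite ltNge leNye.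
  by rewrite integral0 lee_fin expR_ge0.
have FL : F (mix_quantile D X (q - t)) = q - t by apply: mix_cdf_quantile; lra.
set L := mix_quantile D X (q - t) in FL *.
exists L, (fun x => expR (lam t * (Y L x - q))); split.
- by apply: lt_mix_cdf; rewrite mix_cdf_quantile// FL; lra.
- by rewrite FL.
- by move=> t1; exfalso; lra.
split.
- apply: measurableT_comp => //; apply: measurable_funM => //; exact: measurable_funB.
- by move=> x; exact: expR_ge0.
- exact: mgf_lower.
- move=> w a n n0 /quantile_lt[x /ltW xL qx]; rewrite -expR_sum -expR0 ler_expR -mulr_sumr.
  have [l0 _ _] := lamE t0; apply: mulr_ge0 => //.
  rewrite sum_ecdf_dev//; apply: mulr_ge0; first exact: ler0n.
  by rewrite subr_ge0 (le_trans qx)// le_emp_cdf.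
Qed.

End population.

(** * The expected number of samples *)

Section expected_samples.
Context {R : realType} {d d'} {Om : measurableType d} {Om' : measurableType d'}.
Context (P : probability Om' R) (D : probability Om R) (W : nat -> Om' -> Om).
Context (X : Om -> probability R R) (q : R).
Context (iidW : iid_seq P D W) (mX : measurable_kernel X)
  (X0 : {ae D, forall w, forall x : R, X w [set x] = 0%E}) (q01 : 0 <= q <= 1).

Local Notation F := (mix_cdf D X).
Local Notation N := (mix_quantile D X q).
Local Notation s2 := (sigma_q2 D X q).
Local Notation Xs w := (fun i => X (W i w)).

Lemma measurable_sample_kernel i : measurable_kernel (fun w => X (W i w)).
Proof. by move=> A mA; apply: (measurableT_comp (mX mA)); exact: measurable_sample iidW i. Qed.

Lemma measurable_past_sample_kernel m i : (i < m)%N ->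
  measurable_kernel ((fun w => X (W i w)) : past W m -> _).
Proof. by move=> im A mA; apply: (measurableT_comp (mX mA)); exact: measurable_sample_past. Qed.

Lemma integral_sample i (g : Om -> R) : measurable_fun setT g -> (forall x, 0 <= g x) ->
  (\int[P]_w (g (W i w))%:E = \int[D]_x (g x)%:E)%E.
Proof.
move=> mg g0; rewrite (eq_integral (fun w => cst 1%E w * (EFin \o g) (W i w))%E); last first.
  by move=> w _; rewrite mul1e.
rewrite (past_integral iidW)//; last exact/measurable_EFinP.
by rewrite [X in (X * _)%E](_ : _ = 1%E) ?mul1e//; exact: integral_probability_one.
Qed.

(** Sample [i] lies beyond the first [T] ones, so its factor [b] splits off the product by
    independence. *)
Lemma prod_sample_le T i (g b : Om -> R) a c : (T <= i)%N ->
  measurable_fun setT g -> (forall x, 0 <= g x) -> 0 <= a ->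
  (\int[D]_x (g x)%:E <= a%:E)%E ->
  measurable_fun setT b -> (forall x, 0 <= b x) ->
  (\int[D]_x (b x)%:E <= c%:E)%E ->
  (\int[P]_w (\prod_(0 <= j < 0 + T) g (W j w) * b (W i w))%:E <= (a ^+ T * c)%:E)%E.
Proof.
move=> Ti mg g0 a0 ga mb b0 bc.
have p0 w : 0 <= \prod_(0 <= j < 0 + T) g (W j w) by exact: prodr_ge0.
under eq_integral do rewrite EFinM.
rewrite (past_integral iidW (h := fun w => (\prod_(0 <= j < 0 + T) g (W j w))%:E)
  (g := EFin \o b))//=; first last.
- exact/measurable_EFinP.
- apply/measurable_EFinP; apply: past_leq Ti _ _ _ _.
  exact: (measurable_past_prod (m := 0)).
rewrite EFinM; apply: lee_pmul => //.
- by apply: integral_ge0 => w _; rewrite lee_fin.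
- by apply: integral_ge0 => w _; rewrite lee_fin.
have := past_prod_le iidW (m := 0) T (h := cst 1) (fun=> ler01) (measurable_cst _) g0 mg a0 ga.
under eq_integral do rewrite mul1r.
rewrite [X in (_ <= _ * X)%E -> _](_ : _ = 1%E) ?mule1//.
exact: integral_probability_one.
Qed.

(** Take the last [k < K] whose bracket misses [Q]: the next bracket contains [Q] and its width
    bounds the deviation. If none misses [Q], bracket 0 does. *)
Lemma ecdf_dev_bracket_sum (mu : probability R R) (M Q : \bar R) (L U : nat -> \bar R) K :
  (forall k, L k <= M)%E -> (forall k, M <= U k)%E -> (L K <= Q)%E -> (Q <= U K)%E ->
  `|ecdf mu Q - ecdf mu M| <= ecdf mu (U 0) - ecdf mu (L 0) +
    \sum_(k < K) ((U k < Q)%E || (Q < L k)%E)%:R * (ecdf mu (U k.+1) - ecdf mu (L k.+1)).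
Proof.
move=> LM MU.
have B0 k : 0 <= ecdf mu (U k) - ecdf mu (L k).
  by rewrite subr_ge0; apply: le_ecdf; exact: le_trans (LM k) (MU k).
have H k : (L k <= Q)%E -> (Q <= U k)%E ->
    `|ecdf mu Q - ecdf mu M| <= ecdf mu (U k) - ecdf mu (L k).
  move=> /(le_ecdf mu) h1 /(le_ecdf mu) h2.
  have := le_ecdf mu (LM k); have := le_ecdf mu (MU k).
  by rewrite ler_norml; lra.
elim: K => [|K IH] LQ QU; first by rewrite big_ord0 addr0 H.
rewrite big_ord_recr /=; case: (ltP (U K) Q) => UQ /=.
  apply: le_trans (H _ LQ QU) _; rewrite mul1r addrA lerDr addr_ge0//.
  by apply: sumr_ge0 => k _; rewrite mulr_ge0.
case: (ltP Q (L K)) => QL /=; last by rewrite mul0r addr0; exact: IH.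
apply: le_trans (H _ LQ QU) _; rewrite mul1r addrA lerDr addr_ge0//.
by apply: sumr_ge0 => k _; rewrite mulr_ge0.
Qed.

Lemma sum_half_le n : \sum_(k < n) (2^-1 : R) ^+ k <= 2.
Proof.
suff -> : \sum_(k < n) (2^-1 : R) ^+ k = 2 - 2 * 2^-1 ^+ n.
  have : 0 <= (2^-1 : R) ^+ n by rewrite exprn_ge0.
  lra.
elim: n => [|n IH]; first by rewrite big_ord0 expr0; lra.
by rewrite big_ord_recr /= IH exprS; field.
Qed.

(** Beyond [s2] the denominator of the rate is at most [16 t], so the exponent grows at least
    linearly in [t]. *)
Lemma rate_ge t : s2 <= t -> 0 < t -> t / 16 <= rate D X q t.
Proof.
move=> st t0; have s0 : 0 <= s2 by exact: sigma_q2_ge0.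
rewrite /rate ler_pdivlMr; last by lra.
have -> : t / 16 * (8 * (t + s2)) = t * (t + s2) / 2 by field.
have : 0 <= t * (t - s2) by apply: mulr_ge0; lra.
by rewrite expr2; lra.
Qed.

(** Starting from [s2 + 1 / T] keeps all levels above [s2], where the rate is at least [t / 16], and
    gives [T t_k >= 2 ^ k]. *)
Let dyad T (k : nat) : R := 2 ^+ k * (s2 + T%:R^-1).

(** The exponential is at most [exp (- 2 ^ k / 16) <= 2 ^ 10 / 4 ^ k]; multiplying by a level of
    order [2 ^ k] leaves geometric decay. *)
Lemma rate_dyad_le T k : (0 < T)%N ->
  expR (- rate D X q (dyad T k)) ^+ T * dyad T k.+1 <=
  2 ^+ 11 * (s2 + T%:R^-1) * 2^-1 ^+ k.
Proof.
move=> T0; have s0 : 0 <= s2 by exact: sigma_q2_ge0.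
have T0' : 0 < T%:R^-1 :> R by rewrite invr_gt0 ltr0n.
have p1 : 1 <= (2 : R) ^+ k by rewrite exprn_ege1// ler1n.
have t0 : 0 < dyad T k by rewrite mulr_gt0//; lra.
have st : s2 <= dyad T k.
  by rewrite /dyad -[leLHS]mul1r; apply: ler_pM => //; lra.
have r := rate_ge st t0.
have e : expR (- rate D X q (dyad T k)) ^+ T <= 2 ^+ 10 / (2 ^+ k) ^+ 2.
  rewrite -expRM_natl mulrN.
  apply: (@le_trans _ _ (expR (- (2 ^+ k / 16)))).
    rewrite ler_expR lerN2.
    apply: (@le_trans _ _ (T%:R * (dyad T k / 16))); last by rewrite ler_wpM2l.
    have -> : T%:R * (dyad T k / 16) = 2 ^+ k / 16 * (T%:R * s2 + 1).
      by rewrite /dyad; field; rewrite pnatr_eq0 -lt0n.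
    have : 0 <= T%:R * s2 by rewrite mulr_ge0.
    by move=> ?; rewrite ler_peMr//; lra.
  have k0 : 0 < (2 : R) ^+ k / 16 by lra.
  apply: le_trans (expRN_le_inv_sqr k0) _.
  by rewrite le_eqVlt; apply/orP; left; apply/eqP; field; lra.
apply: le_trans (ler_wpM2r _ e) _.
  by rewrite /dyad mulr_ge0// ?exprn_ge0//; lra.
rewrite /dyad [2 ^+ k.+1]exprS exprVn le_eqVlt; apply/orP; left; apply/eqP.
set p := 2 ^+ k in p1 *; set v := s2 + _.
by field; lra.
Qed.

(** The part [6] bounds the variance term and the innermost bracket, [2 s2 + 4 (s2 + 1 / T)]. The
    part [2 ^ 15] is [2 ^ 11] from one level, times 2 each for the two sides, the bracket width
    [2 t], the factor of the deviation and the geometric sum. *)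
Let C0 : R := 6 + 2 ^+ 15.

(* The indicator that the first-batch quantile leaves the k-th dyadic bracket is at most
   [G k + H k], products over the first batch; times the bracket width at a fresh sample
   this is again a product, so no conditioning on the quantile is needed. *)
Lemma second_moment_le T i : (0 < T)%N -> (T <= i)%N ->
  (\int[P]_w ((ecdf (X (W i w)) (quantile_of (fun x => emp_cdf (Xs w) 0 T x%:E) q) - q) ^+ 2)%:E
    <= (C0 * (s2 + T%:R^-1))%:E)%E.
Proof.
move=> T0 Ti; have s0 : 0 <= s2 by exact: sigma_q2_ge0.
have T0' : 0 < T%:R^-1 :> R by rewrite invr_gt0 ltr0n.
have t0 k : 0 < dyad T k by rewrite mulr_gt0 ?exprn_gt0//; lra.
have [U] := choice (fun k => upper_bracket mX X0 q01 (t0 k)).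
move=> /choice[g gP].
have [L] := choice (fun k => lower_bracket mX X0 q01 (t0 k)).
move=> /choice[h hP].
pose Q w := quantile_of (fun x => emp_cdf (Xs w) 0 T x%:E) q.
pose B k x := ecdf (X x) (U k) - ecdf (X x) (L k).
have LN k : (L k <= N)%E by have [] := hP k.
have NU k : (N <= U k)%E by have [] := gP k.
have B0 k x : 0 <= B k x by rewrite subr_ge0 le_ecdf// (le_trans (LN k)).
have mB k : measurable_fun setT (B k).
  by apply: measurable_funB; exact: measurable_ecdf_at.
have iB k : (\int[D]_x (B k x)%:E <= (2 * dyad T k)%:E)%E.
  apply: le_trans (integral_le_combination mX X0 q01 (a := 0) (b := 1) (c := -1) (k := 0)
    (e := U k) (e' := L k) (mB k) (B0 k) _) _.
    by move=> x; rewrite /B; lra.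
  have [_ FU _ _] := gP k; have [_ FL _ _] := hP k.
  by rewrite lee_fin; lra.
(* As [2 ^ T > T], level [T] exceeds 1 and its bracket is the whole line, so finitely many levels
   suffice. *)
have tT : 1 < dyad T T.
  rewrite /dyad; apply: (@lt_le_trans _ _ (2 ^+ T * T%:R^-1)).
    by rewrite ltr_pdivlMr ?ltr0n// mul1r -natrX ltr_nat ltn_expl.
  by rewrite ler_wpM2l ?exprn_ge0//; lra.
pose G k w := \prod_(0 <= j < 0 + T) g k (W j w).
pose H k w := \prod_(0 <= j < 0 + T) h k (W j w).
have G0 k w : 0 <= G k w by apply: prodr_ge0 => j _; have [_ _ _ []] := gP k.
have H0 k w : 0 <= H k w by apply: prodr_ge0 => j _; have [_ _ _ []] := hP k.
have mG k : measurable_fun setT (G k).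
  apply: measurable_prod => j _; apply: measurableT_comp; last exact: measurable_sample iidW j.
  by have [_ _ _ []] := gP k.
have mH k : measurable_fun setT (H k).
  apply: measurable_prod => j _; apply: measurableT_comp; last exact: measurable_sample iidW j.
  by have [_ _ _ []] := hP k.
pose V x := (ecdf (X x) N - q) ^+ 2.
(* [r] majorises the squared deviation: twice the one at [N], plus twice the bracket sum with
   indicators replaced by [G] and [H]. *)
pose r w := 2 * V (W i w) + 2 * B 0 (W i w) +
  \sum_(k < T) (2 * (G k w * B k.+1 (W i w)) + 2 * (H k w * B k.+1 (W i w))).
have mW := measurable_sample iidW i.
have mV : measurable_fun setT (fun w => V (W i w)).
  apply: measurableT_comp mW; apply: measurable_funX; apply: measurable_funB => //.
  exact: measurable_ecdf_at.
have mBW k : measurable_fun setT (fun w => B k (W i w)) by exact: measurableT_comp.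
have mQ : measurable_fun setT Q.
  apply: (measurable_emp_quantile (Y := fun i w => X (W i w))) => j _.
  exact: measurable_sample_kernel.
have mt k : measurable_fun setT
    (fun w => 2 * (G k w * B k.+1 (W i w)) + 2 * (H k w * B k.+1 (W i w))).
  by apply: measurable_funD; apply: measurable_funM => //; exact: measurable_funM.
have mr1 : measurable_fun setT (fun w => 2 * V (W i w) + 2 * B 0 (W i w)).
  by apply: measurable_funD; apply: measurable_funM.
have mr : measurable_fun setT r.
  by apply: measurable_funD => //; apply: measurable_sum.
have V0 x : 0 <= V x by exact: sqr_ge0.
apply: (@le_trans _ _ (\int[P]_w (r w)%:E)%E).
  apply: ge0_le_integral => //.
  - by move=> w _; rewrite lee_fin sqr_ge0.
  - apply/measurable_EFinP; apply: measurable_funX; apply: measurable_funB => //.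
    by apply: measurable_ecdf => //; exact: measurable_sample_kernel.
  - exact/measurable_EFinP.
  move=> w _; rewrite -/(Q w) lee_fin.
  set x := W i w.
  have LQ : (L T <= Q w)%E by have [_ _ /(_ tT) -> _] := hP T; exact: leNye.
  have QU : (Q w <= U T)%E by have [_ _ /(_ tT) -> _] := gP T; exact: leey.
  have dev := ecdf_dev_bracket_sum (X x) LN NU LQ QU.
  (* Two distribution values differ by at most 1, so the square of their distance is replaced by the
     distance itself, to which the bracket sum applies. *)
  have sq : (ecdf (X x) (Q w) - q) ^+ 2 <= 2 * V x + 2 * `|ecdf (X x) (Q w) - ecdf (X x) N|.
    have := ecdf_ge0 (X x) (Q w); have := ecdf_le1 (X x) (Q w).
    have := ecdf_ge0 (X x) N; have := ecdf_le1 (X x) N => a1 a2 a3 a4.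
    have : `|ecdf (X x) (Q w) - ecdf (X x) N| ^+ 2 <= `|ecdf (X x) (Q w) - ecdf (X x) N|.
      by rewrite expr2 ler_piMr// ler_norml; lra.
    rewrite (real_normK (num_real _)) /V.
    have : 0 <= (ecdf (X x) (Q w) - 2 * ecdf (X x) N + q) ^+ 2 by exact: sqr_ge0.
    have -> : (ecdf (X x) (Q w) - 2 * ecdf (X x) N + q) ^+ 2 =
      2 * (ecdf (X x) (Q w) - ecdf (X x) N) ^+ 2 + 2 * (ecdf (X x) N - q) ^+ 2 -
      (ecdf (X x) (Q w) - q) ^+ 2 by ring.
    lra.
  apply: le_trans sq _; rewrite /r -/x -addrA lerD2l.
  have -> : 2 * B 0 x + \sum_(k < T) (2 * (G k w * B k.+1 x) + 2 * (H k w * B k.+1 x)) =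
      2 * (B 0 x + \sum_(k < T) (G k w + H k w) * B k.+1 x).
    by rewrite [RHS]mulrDr mulr_sumr; congr (_ + _); apply: eq_bigr => k _; ring.
  rewrite ler_wpM2l//; apply: le_trans dev _; rewrite lerD2l.
  apply: ler_sum => k _; apply: ler_wpM2r; first exact: B0.
  case: (boolP (U k < Q w)%E) => UQ /=.
    have [_ _ _ [_ _ _ /(_ (W ^~ w) 0%N T T0 UQ) G1]] := gP k.
    by rewrite -[leLHS]addr0; apply: lerD.
  case: (boolP (Q w < L k)%E) => QL /=; last by rewrite addr_ge0.
  have [_ _ _ [_ _ _ /(_ (W ^~ w) 0%N T T0 QL) H1]] := hP k.
  by rewrite -[leLHS]add0r; apply: lerD.
have t0' k w : 0 <= 2 * (G k w * B k.+1 (W i w)) + 2 * (H k w * B k.+1 (W i w)).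
  by rewrite addr_ge0// !mulr_ge0.
under eq_integral do rewrite EFinD.
rewrite ge0_integralD//=; first last.
- by apply/measurable_EFinP; apply: measurable_sum.
- by move=> w _; rewrite lee_fin sumr_ge0.
- exact/measurable_EFinP.
- by move=> w _; rewrite lee_fin addr_ge0// mulr_ge0.
have Cint (f : Om' -> R) c : measurable_fun setT f -> (forall w, 0 <= f w) ->
    (\int[P]_w (f w)%:E <= c%:E)%E -> (\int[P]_w (2 * f w)%:E <= (2 * c)%:E)%E.
  move=> mf f0 fc; under eq_integral do rewrite EFinM.
  rewrite ge0_integralZl_EFin//.
  - by rewrite EFinM lee_pmul2l.
  - by move=> w _; rewrite lee_fin.
  - exact/measurable_EFinP.
have Dint (f f' : Om' -> R) c c' : measurable_fun setT f -> (forall w, 0 <= f w) ->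
    measurable_fun setT f' -> (forall w, 0 <= f' w) ->
    (\int[P]_w (f w)%:E <= c%:E)%E -> (\int[P]_w (f' w)%:E <= c'%:E)%E ->
    (\int[P]_w (f w + f' w)%:E <= (c + c')%:E)%E.
  move=> mf f0 mf' f0' fc fc'; under eq_integral do rewrite EFinD.
  rewrite ge0_integralD//.
  - by rewrite EFinD leeD.
  - by move=> w _; rewrite lee_fin.
  - exact/measurable_EFinP.
  - by move=> w _; rewrite lee_fin.
  - exact/measurable_EFinP.
have a0 k : 0 <= expR (- rate D X q (dyad T k)) by exact: expR_ge0.
have Gle k : (\int[P]_w (G k w * B k.+1 (W i w))%:E <=
    (2 ^+ 12 * (s2 + T%:R^-1) * 2^-1 ^+ k)%:E)%E.
  have [_ _ _ [mg g0 gi _]] := gP k.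
  apply: le_trans (prod_sample_le Ti mg g0 (a0 k) gi (mB k.+1) (B0 k.+1) (iB k.+1)) _.
  by rewrite lee_fin; have := rate_dyad_le k T0; lra.
have Hle k : (\int[P]_w (H k w * B k.+1 (W i w))%:E <=
    (2 ^+ 12 * (s2 + T%:R^-1) * 2^-1 ^+ k)%:E)%E.
  have [_ _ _ [mh h0 hi _]] := hP k.
  apply: le_trans (prod_sample_le Ti mh h0 (a0 k) hi (mB k.+1) (B0 k.+1) (iB k.+1)) _.
  by rewrite lee_fin; have := rate_dyad_le k T0; lra.
have first_le : (\int[P]_w (2 * V (W i w) + 2 * B 0 (W i w))%:E <=
    (2 * s2 + 2 * (2 * (s2 + T%:R^-1)))%:E)%E.
  apply: Dint; rewrite /=; try by [apply: measurable_funM|move=> w; rewrite mulr_ge0].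
  - apply: Cint => //.
    rewrite (@integral_sample i V)//; last first.
      by apply: measurable_funX; apply: measurable_funB => //; exact: measurable_ecdf_at.
    apply: le_trans (integral_le_combination mX X0 q01 (a := 0) (b := 0) (c := 0) (k := 1)
      (e := N) (e' := N) _ V0 _) _.
    + by apply: measurable_funX; apply: measurable_funB => //; exact: measurable_ecdf_at.
    + by move=> x; rewrite /V; lra.
    + by rewrite lee_fin; lra.
  - apply: Cint => //; rewrite integral_sample//.
    by have := iB 0; rewrite /dyad expr0 mul1r.
have sum_le : (\int[P]_w (\sum_(k < T) (2 * (G k w * B k.+1 (W i w)) +
      2 * (H k w * B k.+1 (W i w))))%:E <= (2 ^+ 15 * (s2 + T%:R^-1))%:E)%E.
  under eq_integral do rewrite -sumEFin.
  rewrite ge0_integral_sum//; first last.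
  - by move=> k w _; rewrite lee_fin.
  - by move=> k; exact/measurable_EFinP.
  apply: (@le_trans _ _ (\sum_(k < T) (2 ^+ 14 * (s2 + T%:R^-1) * 2^-1 ^+ k)%:E)%E).
    apply: lee_sum => k _.
    rewrite [X in (_ <= X%:E)%E](_ : _ = 2 * (2 ^+ 12 * (s2 + T%:R^-1) * 2^-1 ^+ k) +
       2 * (2 ^+ 12 * (s2 + T%:R^-1) * 2^-1 ^+ k)); last by ring.
    apply: Dint; try by [apply: measurable_funM => //; exact: measurable_funM|
      move=> w; rewrite !mulr_ge0].
    + by apply: Cint => [|w|//]; [exact: measurable_funM|rewrite mulr_ge0].
    + by apply: Cint => [|w|//]; [exact: measurable_funM|rewrite mulr_ge0].
  rewrite sumEFin lee_fin -mulr_sumr.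
  have -> : 2 ^+ 15 * (s2 + T%:R^-1) = 2 ^+ 14 * (s2 + T%:R^-1) * 2 by ring.
  by rewrite ler_wpM2l ?sum_half_le// mulr_ge0//; lra.
apply: le_trans (leeD first_le sum_le) _.
by rewrite -EFinD lee_fin /C0; lra.
Qed.

(** Up to rounding, the sample count is affine in the variance estimate, so its mean follows from
    the second moment bound at each index of the second batch. Rounding costs 3, absorbed by
    [1 / eps >= 1]. *)
Lemma expected_samples_le (c1 c2 eps : R) : 0 < c1 -> 0 < c2 -> 0 < eps -> eps <= 1 ->
  (\int[P]_w ((est_samples c1 c2 eps q (Xs w))%:R)%:E <=
    ((2 * c1 + 3 + c2 + c2 * C0 * (1 + c1^-1)) * (1 / eps + s2 / eps ^+ 2))%:E)%E.
Proof.
move=> c10 c20 eps0 eps1; have s0 : 0 <= s2 by exact: sigma_q2_ge0.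
pose T := est_T1 c1 eps.
have T0 : (0 < T)%N by [].
have T0R : 0 < T%:R :> R by rewrite ltr0n.
have e2 : 0 < eps ^+ 2 by rewrite exprn_gt0.
have ce : 0 <= c1 / eps by rewrite divr_ge0// ltW.
have T_ge : c1 / eps <= T%:R by exact/ltW/truncnS_gt.
have T_le : T%:R <= c1 / eps + 1.
  by rewrite /T /est_T1 -natr1 lerD2r truncn_le.
pose f i w := (ecdf (X (W i w)) (est_Ntilde c1 eps q (Xs w)) - q) ^+ 2.
have f0 i w : 0 <= f i w by exact: sqr_ge0.
have mf i : measurable_fun setT (f i).
  apply: measurable_funX; apply: measurable_funB => //; apply: measurable_ecdf.
    exact: measurable_sample_kernel.
  apply: (measurable_est_Ntilde (Y := fun i w => X (W i w))) => j _.
  exact: measurable_sample_kernel.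
pose al := 2 * T%:R + 1 + c2 / eps.
pose be := c2 / eps ^+ 2 / T%:R.
have al0 : 0 <= al by rewrite /al !addr_ge0// ?mulr_ge0// ?invr_ge0; lra.
have be0 : 0 <= be by rewrite /be !mulr_ge0// ?invr_ge0; lra.
have mS : measurable_fun setT (fun w => \sum_(T <= i < T + T) f i w).
  by apply: measurable_sum.
apply: (@le_trans _ _ (\int[P]_w (al + be * \sum_(T <= i < T + T) f i w)%:E)%E).
  apply: ge0_le_integral => //.
  - apply/measurable_EFinP; rewrite /est_samples.
    rewrite (_ : (fun w => _) = fun w => (T + T)%:R +
      (est_T2 c1 c2 eps q (Xs w))%:R); last by apply/funext => w; rewrite natrD.
    apply: measurable_funD => //.
    apply: (measurable_est_T2 (Y := fun i w => X (W i w))) => j _.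
    exact: measurable_sample_kernel.
  - apply/measurable_EFinP; apply: measurable_funD => //; exact: measurable_funM.
  - move=> w _; rewrite lee_fin /est_samples -/T !natrD /al -!addrA.
    have -> : be * \sum_(T <= i < T + T) f i w =
        c2 * (est_sigma2 c1 eps q (Xs w) / eps ^+ 2).
      by rewrite /be /est_sigma2 -/T /f; field; lra.
    have sg0 : 0 <= est_sigma2 c1 eps q (Xs w).
      by rewrite /est_sigma2 divr_ge0// sumr_ge0// => i _; exact: sqr_ge0.
    rewrite /est_T2; set z := c2 * _.
    have z0 : 0 <= z.
      rewrite /z; apply: mulr_ge0; first exact: ltW.
      by apply: addr_ge0; apply: divr_ge0 => //; exact: ltW.
    have := truncn_le z; rewrite z0 -natr1 {2}/z mulrDr => /idP ?.
    have -> : c2 / eps = c2 * (1 / eps) by rewrite mul1r.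
    lra.
under eq_integral do rewrite EFinD.
rewrite ge0_integralD//; first last.
- by apply/measurable_EFinP; exact: measurable_funM.
- by move=> w _; rewrite lee_fin mulr_ge0// sumr_ge0.
under [X in (_ + X <= _)%E]eq_integral do rewrite EFinM.
rewrite ge0_integralZl_EFin//; first last.
- exact/measurable_EFinP.
- by move=> w _; rewrite lee_fin sumr_ge0.
under [X in (_ + _ * X <= _)%E]eq_integral do rewrite -sumEFin.
rewrite ge0_integral_sum//; first last.
- by move=> i w _; rewrite lee_fin.
- by move=> i; exact/measurable_EFinP.
have -> : (\int[P]_w al%:E = al%:E)%E.
  by rewrite integral_cst// -[RHS]mule1; congr (_ * _)%E; exact: probability_setT.
apply: (@le_trans _ _ (al%:E + be%:E * (T%:R * (C0 * (s2 + T%:R^-1)))%:E)%E).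
  apply: leeD => //; apply: lee_wpmul2l; first by rewrite lee_fin.
  apply: (@le_trans _ _ (\sum_(T <= i < T + T) (C0 * (s2 + T%:R^-1))%:E)%E).
    rewrite big_seq [leRHS]big_seq; apply: lee_sum => i.
    rewrite mem_index_iota => /andP[Ti _].
    exact: second_moment_le T0 Ti.
  by rewrite sumEFin lee_fin sumr_const_nat addKn mulr_natl.
rewrite -EFinM -EFinD lee_fin.
have -> : be * (T%:R * (C0 * (s2 + T%:R^-1))) = c2 * C0 * (s2 / eps ^+ 2 + T%:R^-1 / eps ^+ 2).
  by rewrite /be; field; lra.
have C00 : 0 <= c2 * C0.
  rewrite mulr_ge0// ?ltW// /C0; have : 0 <= (2 : R) ^+ 15 by exact: exprn_ge0.
  lra.
(* [T >= c1 / eps] turns the [1 / T] error of the first phase, scaled by [1 / eps ^ 2], into a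
   multiple of [1 / eps]. *)
have iT : T%:R^-1 / eps ^+ 2 <= c1^-1 * (1 / eps).
  rewrite ler_pdivrMr//.
  have -> : c1^-1 * (1 / eps) * eps ^+ 2 = (c1 / eps)^-1 by field; lra.
  by rewrite lef_pV2 ?posrE// divr_gt0.
have ie : 1 <= 1 / eps by rewrite ler_pdivlMr// mul1r.
have se : 0 <= s2 / eps ^+ 2 by rewrite divr_ge0// ltW.
have ic : 0 <= c1^-1 by rewrite invr_ge0 ltW.
have h1 := ler_wpM2l C00 iT.
have h2 : 0 <= c2 * C0 * c1^-1 * (s2 / eps ^+ 2) by rewrite mulr_ge0// mulr_ge0.
have h3 : 0 <= (2 * c1 + 3 + c2) * (s2 / eps ^+ 2) by rewrite mulr_ge0//; lra.
have h4 : 0 <= c2 * C0 * (1 / eps) by rewrite mulr_ge0//; lra.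
have -> : (2 * c1 + 3 + c2 + c2 * C0 * (1 + c1^-1)) * (1 / eps + s2 / eps ^+ 2) =
  2 * (c1 / eps) + 3 * (1 / eps) + c2 / eps + c2 * C0 * (s2 / eps ^+ 2) +
  c2 * C0 * (c1^-1 * (1 / eps)) + c2 * C0 * c1^-1 * (s2 / eps ^+ 2) +
  (2 * c1 + 3 + c2) * (s2 / eps ^+ 2) + c2 * C0 * (1 / eps) by field; lra.
rewrite mulrDr /al; lra.
Qed.

End expected_samples.

(** * The success probability *)

Section success_probability.
Context {R : realType} {d d'} {Om : measurableType d} {Om' : measurableType d'}.
Context (P : probability Om' R) (D : probability Om R) (W : nat -> Om' -> Om).
Context (X : Om -> probability R R) (q : R).
Context (iidW : iid_seq P D W) (mX : measurable_kernel X)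
  (X0 : {ae D, forall w, forall x : R, X w [set x] = 0%E}) (q01 : 0 <= q <= 1).

Local Notation F := (mix_cdf D X).
Local Notation N := (mix_quantile D X q).
Local Notation s2 := (sigma_q2 D X q).
Local Notation Xs w := (fun i => X (W i w)).
Local Notation emp_quantile w a n :=
  (quantile_of (fun x => emp_cdf (Xs w) a n x%:E) q).

Lemma probability_le_integral (A : set Om') (f : Om' -> R) :
  measurable A -> measurable_fun setT f -> (forall w, 0 <= f w) ->
  (forall w, A w -> 1 <= f w) -> (P A <= \int[P]_w (f w)%:E)%E.
Proof.
move=> mA mf f0 Af; rewrite -[A in P A]setIT -integral_indic//.
apply: ge0_le_integral => //.
- by apply/measurable_EFinP; exact: measurable_indic.
- exact/measurable_EFinP.
- move=> w _; rewrite lee_fin indicE; case: (boolP (w \in A)) => // /set_mem; exact: Af.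
Qed.

(** Markov's inequality for the indicator of [E] times the product. Keeping a past event [E] allows
    fixing the value of [T2] later. *)
Lemma past_event_le a n (E : set Om') (A : set Om') (g : Om -> R) r :
  measurable (E : set (past W a)) -> measurable A ->
  measurable_fun setT g -> (forall x, 0 <= g x) -> 0 <= r ->
  (\int[D]_x (g x)%:E <= r%:E)%E ->
  (forall w, A w -> 1 <= \prod_(a <= j < a + n) g (W j w)) ->
  (P (E `&` A) <= (r ^+ n)%:E * P E)%E.
Proof.
move=> mE mA mg g0 r0 gr Ag.
have mE' : measurable E by exact: measurable_past iidW _ _ mE.
apply: (@le_trans _ _ (\int[P]_w (\1_E w * \prod_(a <= j < a + n) g (W j w))%:E)%E).
  apply: probability_le_integral.
  - exact: measurableI.
  - apply: measurable_funM; first exact: measurable_indic.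
    apply: measurable_prod => j _; apply: measurableT_comp => //.
    exact: measurable_sample iidW j.
  - by move=> w; rewrite mulr_ge0// prodr_ge0.
  - by move=> w [Ew /Ag]; rewrite indicE mem_set// mul1r.
apply: le_trans (past_prod_le iidW n _ _ g0 mg r0 gr) _ => //.
by rewrite integral_indic// setIT.
Qed.

Lemma measurable_sample_quantile a n : measurable_fun setT (fun w => emp_quantile w a n).
Proof.
apply: (measurable_emp_quantile (Y := fun i w => X (W i w))) => i _.
exact: measurable_sample_kernel iidW mX i.
Qed.

Lemma overshoot_le a n (E : set Om') t U g : (0 < n)%N ->
  measurable (E : set (past W a)) -> upper_certificate D X q t U g ->
  (P (E `&` [set w | (U < emp_quantile w a n)%E]) <=
    (expR (- rate D X q t) ^+ n)%:E * P E)%E.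
Proof.
move=> n0 mE [mg g0 gi gQ]; apply: (past_event_le mE _ mg g0 _ gi) => //.
- by apply: measurable_gt_ereal; exact: measurable_sample_quantile.
- by move=> w; exact: (gQ (W ^~ w)).
Qed.

Lemma undershoot_le a n (E : set Om') t L h : (0 < n)%N ->
  measurable (E : set (past W a)) -> lower_certificate D X q t L h ->
  (P (E `&` [set w | (emp_quantile w a n < L)%E]) <=
    (expR (- rate D X q t) ^+ n)%:E * P E)%E.
Proof.
move=> n0 mE [mh h0 hi hQ]; apply: (past_event_le mE _ mh h0 _ hi) => //.
- by apply: measurable_lt_ereal; exact: measurable_sample_quantile.
- by move=> w; exact: (hQ (W ^~ w)).
Qed.

Context (c1 c2 eps : R) (c1_gt0 : 0 < c1) (c2_gt0 : 0 < c2) (eps_gt0 : 0 < eps).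
Let T1 := est_T1 c1 eps.
Let T2 w := est_T2 c1 c2 eps q (Xs w).

Let past_T2_eq n : measurable ([set w | T2 w = n] : set (past W (T1 + T1))).
Proof.
apply: (measurable_est_T2_eq (Y := (fun i w => X (W i w)) : nat -> past W (T1 + T1) -> _)).
by move=> i iT; exact: measurable_past_sample_kernel.
Qed.

(* The sample size [T2] is determined by the first [T1 + T1] samples, so conditioning on
   its value leaves the third batch i.i.d. *)
Lemma random_size_le r k (B : nat -> set Om') : 0 <= r ->
  (forall n, measurable (B n)) ->
  (forall n (E : set Om'), (0 < n)%N -> measurable (E : set (past W (T1 + T1))) ->
    (P (E `&` B n) <= (expR (- r) ^+ n)%:E * P E)%E) ->
  (P [set w | (k <= (T2 w)%:R * r)%R /\ B (T2 w) w] <= (expR (- k))%:E)%E.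
Proof.
move=> r0 mB PB.
(* Sizes start at 1 since [T2] is a successor. For fixed [n] the condition on [k] is a constant, so
   [E n] is [T2 = n + 1] or empty, in either case an event of the past. *)
pose E n := [set w | T2 w = n.+1 /\ k <= n.+1%:R * r].
have pE n : measurable (E n : set (past W (T1 + T1))).
  rewrite /E; case: (leP k (n.+1%:R * r)) => _.
    by rewrite (_ : mkset _ = [set w | T2 w = n.+1]) ?predeqE//=; split=> // -[].
  by rewrite (_ : mkset _ = set0) ?predeqE//=; split=> // -[].
have mE n : measurable (E n) by exact: measurable_past iidW _ _ (pE n).
have tE : trivIset setT E.
  apply/trivIsetP => i j _ _ /eqP ij; rewrite predeqE => w; split=> // -[[Ti _] [Tj _]];
  by apply: ij; move: Ti; rewrite Tj => -[].
rewrite (_ : mkset _ = \bigcup_n (E n `&` B n.+1)); last first.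
  apply/seteqP; split=> w /=.
    move=> [kT BT]; exists (T2 w).-1 => //; rewrite /E/= prednK//.
  by move=> [n _ [[/= -> ?] ?]].
have mEB n : measurable (E n `&` B n.+1) by exact: measurableI.
apply: le_trans (generalized_Boole_inequality P mEB _) _.
  exact: bigcupT_measurable.
apply: (@le_trans _ _ (\sum_(0 <= n <oo) (expR (- k))%:E * P (E n))%E).
  apply: lee_nneseries => // n _.
  apply: le_trans (PB n.+1 _ isT (pE n)) _.
  (* A point of [E n] provides [k <= (n + 1) r], hence a factor uniform in [n]; the disjoint events
     [E n] then have total probability at most 1. *)
  have [[w [_ kn]]|/set0P/negP/negPn/eqP ->] := pselect (E n !=set0); last first.
    by rewrite measure0 !mule0.
  by apply: lee_wpmul2r => //; rewrite lee_fin -expRM_natl ler_expR mulrN lerN2.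
rewrite nneseriesZl//.
rewrite -[leRHS]mule1; apply: lee_wpmul2l; first by rewrite lee_fin expR_ge0.
rewrite (_ : (\sum_(0 <= n <oo) P (E n))%E = P (\bigcup_n E n)); last first.
  by apply: cvg_lim => //; exact: measure_sigma_additive.
by apply: probability_le1; exact: bigcupT_measurable.
Qed.

Let sg2 w := est_sigma2 c1 eps q (Xs w).

Lemma T1_ge : c1 / eps <= T1%:R.
Proof. exact/ltW/truncnS_gt. Qed.

(** Substituting the formula for [T2] cancels the powers of [eps]: it remains to compare
    [eps + sg2 w] with [eps + s2]. *)
Lemma T2_rate_ge w : c2 * (eps + sg2 w) / (8 * (eps + s2)) <= (T2 w)%:R * rate D X q eps.
Proof.
have s0 : 0 <= s2 by exact: sigma_q2_ge0.
have e0 := eps_gt0; have c0 := c2_gt0.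
have -> : c2 * (eps + sg2 w) / (8 * (eps + s2)) =
    c2 * (1 / eps + sg2 w / eps ^+ 2) * rate D X q eps.
  by rewrite /rate; field; lra.
apply: ler_wpM2r; first by rewrite /rate divr_ge0 ?sqr_ge0//; lra.
exact/ltW/truncnS_gt.
Qed.

(* A lower bound, uniform over [e] in [L, U], for the summands of the variance estimate. *)
Let Z (L U : \bar R) x :=
  (ecdf (X x) N - q) ^+ 2 / 2 - (ecdf (X x) U - ecdf (X x) L).

(** [(Y_N - q) ^ 2 / 2] is at most [(Y_e - q) ^ 2 + (Y_e - Y_N) ^ 2], and the last square is at most
    the bracket width, as values lie in [[0, 1]]. *)
Lemma ecdf_dev_ge (L U e : \bar R) x : (L <= N)%E -> (N <= U)%E -> (L <= e)%E -> (e <= U)%E ->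
  Z L U x <= (ecdf (X x) e - q) ^+ 2.
Proof.
move=> /(le_ecdf (X x)) LN /(le_ecdf (X x)) NU /(le_ecdf (X x)) Le /(le_ecdf (X x)) eU.
have := ecdf_ge0 (X x) L; have := ecdf_le1 (X x) U => u1 l0.
have h : (ecdf (X x) e - ecdf (X x) N) ^+ 2 <= ecdf (X x) U - ecdf (X x) L.
  rewrite -(real_normK (num_real _)).
  have a1 : `|ecdf (X x) e - ecdf (X x) N| <= ecdf (X x) U - ecdf (X x) L.
    by rewrite ler_norml; lra.
  have a2 : `|ecdf (X x) e - ecdf (X x) N| <= 1 by apply: le_trans a1 _; lra.
  by apply: le_trans _ a1; rewrite expr2 ler_piMr.
rewrite /Z.
have : 0 <= (2 * ecdf (X x) e - ecdf (X x) N - q) ^+ 2 by exact: sqr_ge0.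
have -> : (2 * ecdf (X x) e - ecdf (X x) N - q) ^+ 2 =
  2 * (ecdf (X x) e - q) ^+ 2 + 2 * (ecdf (X x) e - ecdf (X x) N) ^+ 2 -
  (ecdf (X x) N - q) ^+ 2 by ring.
lra.
Qed.

(** The mean of [Z] is at least [3 s2 / 8], a margin [s2 / 4] over the threshold; its second moment
    is at most [s2 / 2 + s2 / 8]. With exponent [1 / 5] the first-order gain is [s2 / 20] and the
    second-order loss at most [s2 / 40]. *)
Lemma mgf_Z L U : (L <= N)%E -> (N <= U)%E -> F U - F L <= s2 / 8 ->
  (\int[D]_x (expR (5^-1 * (s2 / 8 - Z L U x)))%:E <= (expR (- (s2 / 40)))%:E)%E.
Proof.
move=> LN NU FUL.
have s0 : 0 <= s2 by exact: sigma_q2_ge0.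
have s1 : s2 <= 1 by exact: sigma_q2_le1.
(* Coefficient of the bracket width: [1 / 5] from the linear term, [1 / 25] from the square,
   [s2 / 100] from the cross term. *)
pose b := 5^-1 + 25^-1 + 25^-1 * s2 / 4.
apply: le_trans (integral_le_combination mX X0 q01 (a := 1 + s2 / 40 + s2 ^+ 2 / 1600)
  (b := b) (c := - b) (k := - 10^-1 + 50^-1 - s2 / 200) (e := U) (e' := L) _ _ _) _.
- apply: measurableT_comp => //; apply: measurable_funM => //; apply: measurable_funB => //.
  apply: measurable_funB; last by apply: measurable_funB; exact: measurable_ecdf_at.
  apply: measurable_funM => //; apply: measurable_funX; apply: measurable_funB => //.
  exact: measurable_ecdf_at.
- by move=> x; exact: expR_ge0.
- move=> x.
  have := le_ecdf (X x) LN; have := le_ecdf (X x) NU => NUx LNx.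
  have := ecdf_ge0 (X x) L; have := ecdf_le1 (X x) U => u1 l0.
  have v0 : 0 <= (ecdf (X x) N - q) ^+ 2 by exact: sqr_ge0.
  have v1 : (ecdf (X x) N - q) ^+ 2 <= 1 by exact: sqr_ecdf_dev_le1.
  rewrite /Z; set v := (ecdf (X x) N - q) ^+ 2 in v0 v1 *.
  set B := ecdf (X x) U - ecdf (X x) L.
  have B0 : 0 <= B by rewrite /B; lra.
  have B1 : B <= 1 by rewrite /B; lra.
  have z1 : (v / 2 - B) ^+ 2 <= v / 2 + B.
    have : 0 <= v * (1 - v) by rewrite mulr_ge0//; lra.
    have : 0 <= B * (1 - B) by rewrite mulr_ge0//; lra.
    have : 0 <= v * B by rewrite mulr_ge0.
    have -> : (v / 2 - B) ^+ 2 = v / 4 - v * (1 - v) / 4 + B - B * (1 - B) - v * B by field.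
    lra.
  (* The argument is at most [9 / 40 < 1 / 4] in absolute value. *)
  apply: le_trans (expR_le_quadratic _) _.
    by rewrite ler_norml; lra.
  have -> : (5^-1 * (s2 / 8 - (v / 2 - B))) ^+ 2 =
     25^-1 * (v / 2 - B) ^+ 2 - s2 * (v / 2 - B) / 100 + s2 ^+ 2 / 1600 by field.
  have -> : 1 + s2 / 40 + s2 ^+ 2 / 1600 + b * ecdf (X x) U + - b * ecdf (X x) L +
    (- 10^-1 + 50^-1 - s2 / 200) * v = 1 + s2 / 40 + s2 ^+ 2 / 1600 + b * B +
    (- 10^-1 + 50^-1 - s2 / 200) * v by rewrite /B; ring.
  have -> : 1 + s2 / 40 + s2 ^+ 2 / 1600 + b * B + (- 10^-1 + 50^-1 - s2 / 200) * v =
    1 + 5^-1 * (s2 / 8 - (v / 2 - B)) + (25^-1 * (v / 2 + B) - s2 * (v / 2 - B) / 100 +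
    s2 ^+ 2 / 1600) by rewrite /b; field.
  lra.
- rewrite lee_fin; apply: le_trans (expR_ge1Dx _).
  have b0 : 0 <= b by rewrite /b; lra.
  have := ler_wpM2l b0 FUL.
  have -> : b * (s2 / 8) = 3 * s2 / 100 + s2 ^+ 2 / 800 by rewrite /b; field.
  have := sqr_ge0 s2; rewrite /b.
  have -> : (- 10^-1 + 50^-1 - s2 / 200) * s2 = - (2 * s2 / 25) - s2 ^+ 2 / 200 by field.
  lra.
Qed.

Lemma expRN_nat_le n y (k : R) : 0 <= k -> k <= n%:R * y -> expR (- y) ^+ n <= (1 + k)^-1.
Proof.
move=> k0 ky; rewrite -expRM_natl mulrN; apply: le_trans (expRN_le_inv k0).
by rewrite ler_expR lerN2.
Qed.

Lemma sg2_ge0 w : 0 <= sg2 w.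
Proof. by rewrite /sg2 /est_sigma2 divr_ge0// sumr_ge0// => i _; exact: sqr_ge0. Qed.

(* 2176 comes from [rate (s2 / 16) = s2 / 2176], and [exp (- 60) <= 1 / 61]. *)
Lemma sg2_lower_bound : 2176 * 60 <= c1 -> eps < s2 ->
  exists Bad : set Om', [/\ measurable Bad, (P Bad <= (3 / 61)%:E)%E &
    forall w, ~ Bad w -> s2 / 8 <= sg2 w].
Proof.
move=> c1_ge es; have e0 := eps_gt0.
have s1 : s2 <= 1 by exact: sigma_q2_le1.
have T10 : (0 < T1)%N by [].
have T10' : 0 < T1%:R :> R by rewrite ltr0n.
have t0 : 0 < s2 / 16 by lra.
(* [T1 >= c1 / eps] and [s2 > eps] make the exponents [T1 s2 / 2176] and [T1 s2 / 40] large. *)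
have Ts : c1 <= T1%:R * s2.
  apply: (@le_trans _ _ (c1 / eps * s2)); last by rewrite ler_wpM2r ?T1_ge//; lra.
  by rewrite -mulrA ler_peMr ?ltW// mulrC ltr_pdivlMr// mul1r.
have [U [g [NU FU _ certU]]] := upper_bracket mX X0 q01 t0.
have [L [h [LN FL _ certL]]] := lower_bracket mX X0 q01 t0.
have FUL : F U - F L <= s2 / 8 by lra.
pose gz x := expR (5^-1 * (s2 / 8 - Z L U x)).
pose B1 := [set w | (U < emp_quantile w 0 T1)%E].
pose B2 := [set w | (emp_quantile w 0 T1 < L)%E].
(* With [L] and [U] fixed, this event concerns the second batch alone. When the first-phase quantile
   is inside the bracket, an estimate below [s2 / 8] forces it. *)
pose B3 := ~` [set w | \prod_(T1 <= j < T1 + T1) gz (W j w) < 1].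
have mgz : measurable_fun setT gz.
  apply: measurableT_comp => //; apply: measurable_funM => //; apply: measurable_funB => //.
  apply: measurable_funB; last by apply: measurable_funB; exact: measurable_ecdf_at.
  apply: measurable_funM => //; apply: measurable_funX; apply: measurable_funB => //.
  exact: measurable_ecdf_at.
have mB1 : measurable B1 by apply: measurable_gt_ereal; exact: measurable_sample_quantile.
have mB2 : measurable B2 by apply: measurable_lt_ereal; exact: measurable_sample_quantile.
have mB3 : measurable B3.
  apply: measurableC; apply: measurable_lt_real; apply: measurable_prod => j _.
  by apply: measurableT_comp => //; exact: measurable_sample iidW j.
have PT (A : set Om') (r : R) n m : (P (setT `&` A) <= (r ^+ n)%:E * P setT)%E ->
    r ^+ n <= m -> (P A <= m%:E)%E.
  rewrite setTI => PA rm; apply: le_trans PA _.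
  have -> : P setT = 1%E by exact: probability_setT.
  by rewrite mule1 lee_fin.
have rt : rate D X q (s2 / 16) = s2 / 2176 by rewrite /rate; field; lra.
have kr : 60 <= T1%:R * rate D X q (s2 / 16) by rewrite rt; lra.
exists (B1 `|` B2 `|` B3); split.
- by apply: measurableU => //; exact: measurableU.
- apply: le_trans (measureU2 _ _ _) _ => //; first exact: measurableU.
  have -> : 3 / 61 = (1 + 60)^-1 + (1 + 60)^-1 + (1 + 60)^-1 :> R by field.
  rewrite 2!EFinD; apply: leeD; first (apply: le_trans (measureU2 _ _ _) _ => //; apply: leeD).
  + apply: PT (overshoot_le (E := setT) T10 measurableT certU) _.
    by apply: expRN_nat_le.
  + apply: PT (undershoot_le (E := setT) T10 measurableT certL) _.
    by apply: expRN_nat_le.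
  + apply: PT (past_event_le (a := T1) (n := T1) (E := setT) (g := gz) measurableT mB3 mgz _ _
      (mgf_Z LN NU FUL) _) _.
    * by move=> x; exact: expR_ge0.
    * exact: expR_ge0.
    * by move=> w /negP; rewrite -leNgt.
    * by apply: expRN_nat_le => //; lra.
- move=> w nB.
  have QU : (emp_quantile w 0 T1 <= U)%E.
    by rewrite leNgt; apply/negP => ?; apply: nB; left; left.
  have LQ : (L <= emp_quantile w 0 T1)%E.
    by rewrite leNgt; apply/negP => ?; apply: nB; left; right.
  rewrite leNgt; apply/negP => sg_lt; apply: nB; right => /=; apply/negP; rewrite -leNgt.
  rewrite -expR_sum -[X in X <= _]expR0 ler_expR -mulr_sumr; apply: mulr_ge0 => //.
  rewrite sumrB sumr_const_nat addKn subr_ge0.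
  apply: (@le_trans _ _ (T1%:R * sg2 w)); last by rewrite -[leRHS]mulr_natl ler_wpM2l// ltW.
  rewrite /sg2 /est_sigma2 -/T1 mulrCA divff ?mulr1; last by lra.
  by apply: ler_sum => j _; exact: ecdf_dev_ge.
Qed.

(** It is enough that [eps + s2 <= 8 (eps + sg2 w)], true outright when [s2 <= eps]. The constant
    [64 * 60] pays for this 8, for the 8 in the rate and for the exponent 60. *)
Lemma T2_rate_lower_bound : 2176 * 60 <= c1 -> 64 * 60 <= c2 ->
  exists Bad : set Om', [/\ measurable Bad, (P Bad <= (3 / 61)%:E)%E &
    forall w, ~ Bad w -> 60 <= (T2 w)%:R * rate D X q eps].
Proof.
move=> c1_ge c2_ge; have e0 := eps_gt0.
have s0 : 0 <= s2 by exact: sigma_q2_ge0.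
have H w : eps + s2 <= 8 * (eps + sg2 w) -> 60 <= (T2 w)%:R * rate D X q eps.
  move=> le; apply: le_trans _ (T2_rate_ge w).
  rewrite ler_pdivlMr; last lra.
  have -> : 60 * (8 * (eps + s2)) = 8 * 60 * (eps + s2) by ring.
  apply: (@le_trans _ _ (8 * 60 * (8 * (eps + sg2 w)))); first by rewrite ler_wpM2l//; lra.
  have -> : 8 * 60 * (8 * (eps + sg2 w)) = 64 * 60 * (eps + sg2 w) by ring.
  by rewrite ler_wpM2r//; have := sg2_ge0 w; lra.
case: (leP s2 eps) => es.
  exists set0; split=> //; first by rewrite measure0 lee_fin; lra.
  by move=> w _; apply: H; have := sg2_ge0 w; lra.
have [Bad [mB PB nB]] := sg2_lower_bound c1_ge es.
by exists Bad; split=> // w /nB sg; apply: H; lra.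
Qed.

Lemma success_probability_ge : 2176 * 60 <= c1 -> 64 * 60 <= c2 ->
  ((2^-1)%:E <= P [set w | (`|F (est_output c1 c2 eps q (Xs w)) - q| <= eps)%R])%E.
Proof.
move=> c1_ge c2_ge; have e0 := eps_gt0.
have [Bad [mBad PBad nBad]] := T2_rate_lower_bound c1_ge c2_ge.
have [U [g [NU FU _ certU]]] := upper_bracket mX X0 q01 eps_gt0.
have [L [h [LN FL _ certL]]] := lower_bracket mX X0 q01 eps_gt0.
have r0 : 0 <= rate D X q eps.
  by rewrite /rate divr_ge0 ?sqr_ge0//; have := sigma_q2_ge0 mX X0 q01; lra.
(* The size condition is made part of the events, in the form that the bound for a random size
   takes. *)
pose B1 := [set w | 60 <= (T2 w)%:R * rate D X q eps /\ (U < emp_quantile w (T1 + T1) (T2 w))%E].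
pose B2 := [set w | 60 <= (T2 w)%:R * rate D X q eps /\ (emp_quantile w (T1 + T1) (T2 w) < L)%E].
pose out w := est_output c1 c2 eps q (Xs w).
have mout : measurable_fun setT out.
  apply: (measurable_est_output (Y := fun i w => X (W i w))) => i.
    by move=> _; exact: measurable_sample_kernel iidW mX i.
  exact: measurable_sample_kernel iidW mX i.
have mT2 : measurable_fun setT (fun w => (T2 w)%:R : R).
  apply: (measurable_est_T2 (Y := fun i w => X (W i w))) => i _.
  exact: measurable_sample_kernel iidW mX i.
have mk : measurable [set w | 60 <= (T2 w)%:R * rate D X q eps].
  rewrite (_ : mkset _ = ~` [set w | (T2 w)%:R * rate D X q eps < 60]).
    by apply: measurableC; apply: measurable_lt_real; exact: measurable_funM.
  by apply/seteqP; split=> w /=; rewrite leNgt => /negP.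
have mB1 : measurable B1 by apply: measurableI mk _; exact: measurable_gt_ereal mout.
have mB2 : measurable B2 by apply: measurableI mk _; exact: measurable_lt_ereal mout.
have e60 : expR (- 60) <= (1 + 60)^-1 :> R by exact: expRN_le_inv.
have PB1 : (P B1 <= ((1 + 60)^-1)%:E)%E.
  apply: le_trans (random_size_le 60 (B := fun n => [set w | (U < emp_quantile w (T1 + T1) n)%E])
    r0 _ _) _ => [n|n E n0 mE|].
  - by apply: measurable_gt_ereal; exact: measurable_sample_quantile.
  - exact: overshoot_le certU.
  - by rewrite lee_fin.
have PB2 : (P B2 <= ((1 + 60)^-1)%:E)%E.
  apply: le_trans (random_size_le 60 (B := fun n => [set w | (emp_quantile w (T1 + T1) n < L)%E])
    r0 _ _) _ => [n|n E n0 mE|].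
  - by apply: measurable_lt_ereal; exact: measurable_sample_quantile.
  - exact: undershoot_le certL.
  - by rewrite lee_fin.
pose G := [set w | `|F (out w) - q| <= eps].
have mG : measurable G.
  have mF : measurable_fun setT (fun w => `|F (out w) - q|).
    apply: measurableT_comp => //; apply: measurable_funB => //.
    by apply: (measurable_ecdf (Y := fun=> mixture D mX)).
  have := mF measurableT _ (measurable_itv `]-oo, eps]).
  by rewrite setTI; congr measurable; apply/seteqP; split=> w /=; rewrite in_itv.
have cover : setT `<=` G `|` (Bad `|` (B1 `|` B2)).
  move=> w _; have [?|nb] := pselect (Bad w); first by right; left.
  have k := nBad w nb.
  have [?|nb1] := pselect (B1 w); first by right; right; left.
  have [?|nb2] := pselect (B2 w); first by right; right; right.
  left; rewrite /G /=.
  have oU : (out w <= U)%E by rewrite leNgt; apply/negP => ?; exact: nb1.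
  have Lo : (L <= out w)%E by rewrite leNgt; apply/negP => ?; exact: nb2.
  have := le_mix_cdf D mX oU; have := le_mix_cdf D mX Lo.
  by rewrite ler_norml; lra.
have mB12 : measurable (B1 `|` B2) by exact: measurableU.
have mBB : measurable (Bad `|` (B1 `|` B2)) by exact: measurableU.
have le1 : (1 <= P G + P (Bad `|` (B1 `|` B2)))%E.
  apply: le_trans (measureU2 _ mG mBB); rewrite -(probability_setT P).
  by apply: le_measure; rewrite ?inE//; exact: measurableU.
(* The variance estimate costs [3 / 61] and each side of the final quantile [1 / 61]; the total is
   below [1 / 2]. *)
have PBB : (P (Bad `|` (B1 `|` B2)) <= (5 / 61)%:E)%E.
  apply: le_trans (measureU2 _ mBad mB12) _.
  have -> : 5 / 61 = 3 / 61 + ((1 + 60)^-1 + (1 + 60)^-1) :> R by field.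
  rewrite 2!EFinD; apply: leeD => //.
  by apply: le_trans (measureU2 _ mB1 mB2) _; apply: leeD.
have := le_trans le1 (leeD (lexx (P G)) PBB).
have fG : P G \is a fin_num by rewrite fin_num_measure.
by rewrite -(fineK fG) -EFinD !lee_fin; lra.
Qed.

End success_probability.

Theorem theorem4p3 :
  forall (R : realType),
  exists (c1 c2 C p : R), [/\ 0 < c1, 0 < c2, 0 < C & 0 < p] /\
  forall (d d' : measure_display) (Om : measurableType d) (Om' : measurableType d')
    (D : probability Om R) (X : Om -> probability R R)
    (P : probability Om' R) (W : nat -> Om' -> Om) (q eps : R),
    (* D is a distribution over distributions: w |-> X w is a kernel *)
    (forall A : set R, measurable A -> measurable_fun setT (fun w => X w A)) ->
    (* D-almost surely, X w has no atoms *)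
    {ae D, forall w, forall x : R, X w [set x] = 0%E} ->
    0 <= q <= 1 -> 0 < eps -> eps <= 1 ->
    iid_seq P D W ->
    let Xs := fun w (i : nat) => X (W i w) in
    (\int[P]_w ((est_samples c1 c2 eps q (Xs w))%:R)%:E
       <= (C * (1 / eps + sigma_q2 D X q / eps ^+ 2))%:E)%E /\
    (p%:E <= P [set w | (`|mix_cdf D X (est_output c1 c2 eps q (Xs w)) - q| <= eps)%R])%E.
Proof.
(* [c1] and [c2] are the least values accepted by the success bound; the third witness is the
   constant of the expected size for them. *)
move=> R; pose c1 : R := 2176 * 60; pose c2 : R := 64 * 60.
exists c1, c2, (2 * c1 + 3 + c2 + c2 * (6 + 2 ^+ 15) * (1 + c1^-1)), 2^-1.
have c1_gt0 : 0 < c1 by rewrite /c1; lra.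
have c2_gt0 : 0 < c2 by rewrite /c2; lra.
split.
  split=> //.
  rewrite ltr_wpDr ?mulr_ge0// ?addr_ge0 ?invr_ge0 ?exprn_ge0//; try lra.
move=> d d' Om Om' D X P W q eps mX X0 q01 eps_gt0 eps_le1 iidW Xs; split.
  exact: expected_samples_le.
exact: success_probability_ge.
Qed.
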